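(* In $T_{n}$, if $2^{k+1} \leq n$, then $a \perp^{\eth^{k}}_{M} b$ if and only if $a \cap b = M$ (i.e. $a\perp^{a}_M b$). Therefore, there are $\mathrm{SOP}_{2^{k+1}}$ theories where $\perp^{\eth^{k}}$ is symmetric.
   Context: $T_n$ is the model companion (shown to exist by Casanovas and Wagner) of the theory of metric spaces with distances valued in $\{0,\dots,n\}$ (the ''free roots of the complete graph''); it is $\omega$-categorical, eliminates quantifiers, has trivial algebraicity, and is strictly $\mathrm{NSOP}_{n+1}$ (Conant–Terry). Independence notions: $\perp^{\eth^0}$ is forking-independence over a model $M$. For a relation $\perp$, a $\perp$-Morley sequence over $M$ is an $M$-indiscernible sequence $(b_i)_{i<\omega}$ with $b_i\perp_M b_0\dots b_{i-1}$. Inductively, $\varphi(x,b)$ $(j+1)$-$\eth$-divides over $M$ if for every $\perp^{\eth^j}$-Morley sequence $(b_i)$ over $M$ with $b_0=b$, $\{\varphi(x,b_i)\}_{i<\omega}$ is inconsistent; it $(j+1)$-$\eth$-forks over $M$ if it implies a finite disjunction of formulas $(j+1)$-$\eth$-dividing over $M$; and $a\perp^{\eth^{j+1}}_M b$ means $\mathrm{tp}(a/Mb)$ contains no formula $(j+1)$-$\eth$-forking over $M$.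
   Formalization: The condition 2^{k+1} ≤ n is corrected to n ≤ 2^{k+1}: for n > 2^{k+1} the equivalence fails (d(x,b)=1 with b at distance n from M k-ð-divides). For k=0, SOP_2 is read as the 2-cycle version of SOP_m, since symmetric forking excludes the tree property SOP_2. *)

(* Defs.v *)
From mathcomp Require Import all_boot.
From mathcomp Require Import classical_sets cardinality.

Set Implicit Arguments.
Unset Strict Implicit.
Unset Printing Implicit Defensive.

Local Open Scope classical_set_scope.

(** * First-order logic with equality, over relational languages *)

Record language := Language { rel_symbol :> Type; arity : rel_symbol -> nat }.

Record structure (L : language) := Structure {
  carrier :> Type;
  interp : forall r : L, (arity r).-tuple carrier -> Prop }.

(* [formula L V]: formulas whose free variables are taken in [V].  In
   [All p] the bound variable of [p] is [None]. *)
Inductive formula (L : language) (V : Type) : Type :=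
| Bot
| Equal of V & V
| Rel (r : L) of (arity r).-tuple V
| Imp of formula L V & formula L V
| All of formula L (option V).

Arguments Bot {L V}.
Arguments Equal {L V} _ _.
Arguments Rel {L V} r _.
Arguments Imp {L V} _ _.
Arguments All {L V} _.

Definition Neg L V (p : formula L V) : formula L V := Imp p Bot.
Definition Or L V (p q : formula L V) : formula L V := Imp (Neg p) q.

Section Satisfaction.
Variables (L : language) (U : structure L).

Fixpoint sat V (s : V -> U) (p : formula L V) : Prop :=
  match p with
  | Bot => False
  | Equal x y => s x = s y
  | Rel r t => interp [tuple of map s t]
  | Imp p q => sat s p -> sat s q
  | All p => forall u : U, sat (fun v => oapp s u v) p
  end.

End Satisfaction.

Definition sentence L := formula L void.
Definition theory L := set (sentence L).

Definition holds L (U : structure L) (p : sentence L) : Prop :=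
  sat (of_void U) p.

Definition model L (T : theory L) (U : structure L) : Prop :=
  inhabited U /\ (forall p, T p -> holds U p).

Definition complete_theory L (T : theory L) : Prop :=
  (exists U, model T U) /\
  forall p : sentence L,
    (forall U, model T U -> holds U p) \/
    (forall U, model T U -> holds U (Neg p)).

Definition embedding L (A B : structure L) (f : A -> B) : Prop :=
  injective f /\
  forall (r : L) (t : (arity r).-tuple A),
    interp t <-> interp [tuple of map f t].

Definition elementary_embedding L (A B : structure L) (f : A -> B) : Prop :=
  forall m (p : formula L 'I_m) (s : 'I_m -> A), sat s p <-> sat (f \o s) p.

Definition model_complete L (T : theory L) : Prop :=
  forall A B, model T A -> model T B ->
  forall f : A -> B, embedding f -> elementary_embedding f.

Definition embeds_in_models L (T1 T2 : theory L) : Prop :=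
  forall A, model T1 A -> exists B, model T2 B /\ exists f : A -> B, embedding f.

Definition model_companion L (T T0 : theory L) : Prop :=
  [/\ embeds_in_models T0 T, embeds_in_models T T0 & model_complete T].

Definition substructure L (U : structure L) (M : set U) : structure L :=
  @Structure L {x : U | M x} (fun r t => interp [tuple of map sval t]).

Definition elementary_substructure L (U : structure L) (M : set U) : Prop :=
  M !=set0 /\ @elementary_embedding L (substructure M) U sval.

(* [T] has SOP_m.  This is Shelah's definition for [3 <= m], the range in
   which SOP_m is defined by forbidding cycles; the same formula is used for
   every [m]. *)
Definition SOP (m : nat) L (T : theory L) : Prop :=
  exists l (p : formula L ('I_l + 'I_l)),
    let holds_at (U : structure L) (a b : 'I_l -> U) :=
      sat (fun v => match v with inl i => a i | inr i => b i end) p in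
    (exists U, model T U /\ exists a : nat -> 'I_l -> U,
       forall i j, i < j -> holds_at U (a i) (a j)) /\
    (forall U, model T U -> ~ exists c : 'I_m -> 'I_l -> U,
       forall i : 'I_m, holds_at U (c i) (c (ordS i))).

(** * Monster models *)

(* [A] has cardinality less than [K] *)
Definition small (K A : Type) : Prop := ~ exists f : K -> A, injective f.

Definition join (X Y U : Type) (a : X -> U) (b : Y -> U) (v : X + Y) : U :=
  match v with inl x => a x | inr y => b y end.

Definition saturated (K : Type) L (U : structure L) : Prop :=
  forall (A : set U), small K {x | A x} ->
  forall m (p : set (formula L ('I_m + {x | A x}))),
    (forall l (q : 'I_l -> formula L ('I_m + {x | A x})),
       (forall i, p (q i)) ->
       exists c : 'I_m -> U, forall i, sat (join c sval) (q i)) ->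
    exists c : 'I_m -> U, forall q, p q -> sat (join c sval) q.

Definition strongly_homogeneous (K : Type) L (U : structure L) : Prop :=
  forall (X : Type) (a b : X -> U), small K X ->
    (forall p : formula L X, sat a p <-> sat b p) ->
    exists g : U -> U, [/\ bijective g, embedding g & forall x, g (a x) = b x].

(* The monster models of size parameter [K], where [|L| + aleph_0 < |K|] *)
Definition monster (K : Type) L (U : structure L) : Prop :=
  [/\ small K nat, small K L, saturated K U & strongly_homogeneous K U].

(** * Independence over a subset of a monster model *)

Section Independence.
Variables (L : language) (U : structure L) (M : set U).

Definition indiscernible m (b : nat -> 'I_m -> U) : Prop :=
  forall r (s t : 'I_r -> nat),
    {homo s : i j / i < j} -> {homo t : i j / i < j} ->
  forall p : formula L ('I_r * 'I_m + {x | M x}),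
    sat (join (fun v => b (s v.1) v.2) sval) p <->
    sat (join (fun v => b (t v.1) v.2) sval) p.

(* [{p(x, b_i)}_i] is consistent, i.e. realized in the monster model *)
Definition consistent_along X m (p : formula L (X + 'I_m))
    (b : nat -> 'I_m -> U) : Prop :=
  exists a : X -> U, forall i, sat (join a (b i)) p.

(* A notion of dividing for the formulas [p(x, b)], [b] a finite tuple *)
Definition dividing_notion :=
  forall X m, formula L (X + 'I_m) -> ('I_m -> U) -> Prop.

Definition divides : dividing_notion := fun X m p b =>
  exists c, [/\ indiscernible c, c 0 = b & ~ consistent_along p c].

Definition forks (D : dividing_notion) : dividing_notion := fun X m p b =>
  exists (N : nat) (ar : 'I_N -> nat)
         (q : forall l, formula L (X + 'I_(ar l)))
         (c : forall l, 'I_(ar l) -> U),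
    (forall l, D X (ar l) (q l) (c l)) /\
    forall a : X -> U,
      sat (join a b) p -> exists l, sat (join a (c l)) (q l).

(* [tp(a/Mb)] contains no formula that forks in the sense of [D] *)
Definition independent (D : dividing_notion) X Y (a : X -> U) (b : Y -> U)
    : Prop :=
  forall m (p : formula L (X + 'I_m)) (c : 'I_m -> U),
    (forall i, (M `|` range b) (c i)) ->
    sat (join a c) p -> ~ forks D p c.

Definition morley (D : dividing_notion) m (b : nat -> 'I_m -> U) : Prop :=
  indiscernible b /\
  forall i, independent D (b i) (fun v : 'I_i * 'I_m => b v.1 v.2).

Fixpoint eth_divides (j : nat) : dividing_notion :=
  match j with
  | 0 => divides
  | j'.+1 => fun X m p b =>
      forall c, morley (eth_divides j') c -> c 0 = b -> ~ consistent_along p c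
  end.

Definition eth_independent (j : nat) X Y (a : X -> U) (b : Y -> U) : Prop :=
  independent (eth_divides j) a b.

Definition acl (A : set U) : set U := [set u |
  exists m (p : formula L (unit + 'I_m)) (c : 'I_m -> U),
    [/\ forall i, A (c i), sat (join (fun=> u) c) p &
        finite_set [set v | sat (join (fun=> v) c) p]]].

Definition alg_independent X Y (a : X -> U) (b : Y -> U) : Prop :=
  acl (M `|` range a) `&` acl (M `|` range b) = acl M.

End Independence.

Definition eth_symmetric (j : nat) L (T : theory L) : Prop :=
  forall (K : Type) (U : structure L), model T U -> monster K U ->
  forall M : set U, small K {x | M x} -> elementary_substructure M ->
  forall (X Y : Type) (a : X -> U) (b : Y -> U), small K X -> small K Y ->
    eth_independent M j a b -> eth_independent M j b a.

(** * Metric spaces with distances in {0, ..., n} *)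

(* The binary symbol [r] stands for [d(x, y) = r]. *)
Definition metric_language (n : nat) : language := @Language 'I_n.+1 (fun=> 2).

Definition Dist n V (r : 'I_n.+1) (x y : V) : formula (metric_language n) V :=
  @Rel (metric_language n) V r [tuple x; y].

Section MetricAxioms.
Variable n : nat.

Let x1 : option void := None.
Let x2 : option (option void) := Some None.
Let y2 : option (option void) := None.
Let x3 : option (option (option void)) := Some (Some None).
Let y3 : option (option (option void)) := Some None.
Let z3 : option (option (option void)) := None.

Inductive metric_theory : theory (metric_language n) :=
| metric_total :
    metric_theory (All (All (\big[@Or _ _/Bot]_(r < n.+1) Dist r x2 y2)))
| metric_unique (r s : 'I_n.+1) : r != s ->
    metric_theory (All (All (Imp (Dist r x2 y2) (Neg (Dist s x2 y2)))))
| metric_refl :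
    metric_theory (All (Dist (@ord0 n) x1 x1))
| metric_sep :
    metric_theory (All (All (Imp (Dist (@ord0 n) x2 y2) (Equal x2 y2))))
| metric_sym (r : 'I_n.+1) :
    metric_theory (All (All (Imp (Dist r x2 y2) (Dist r y2 x2))))
| metric_triangle (r s t : 'I_n.+1) : r + s < t ->
    metric_theory (All (All (All
      (Imp (Dist r x3 y3) (Imp (Dist s y3 z3) (Neg (Dist t x3 z3))))))).

End MetricAxioms.

Arguments metric_theory n _ : clear implicits.

(* Main.v *)
Require Import Defs.
From mathcomp Require Import all_boot zify.
From mathcomp Require Import boolp classical_sets functions cardinality.
From Stdlib Require List.

(** A model of a model companion of the theory of metric spaces is generic: it
realizes every one-point extension of its finite subspaces.  Hence types are
given by distances.  Let [N = 2 ^ (k + 1)].  By induction on [j <= k], a tuple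
[x] is [j]-eth-independent of [y] over [M] as soon as all distances between
them lie in [[2 ^ (k - j), N - 2 ^ (k - j) + 1]], up to the bounds imposed by
the distances to [M].  For [j = 0] any two such distances differ by at most
one and add up to at least [n], so the distances from [x] may be copied along
any indiscernible sequence.  For [j + 1], amalgamate copies of [y] freely over
[M] and [x], truncated at [N - 2 ^ (k - j) + 1]: the distances between
different copies lie in the previous, narrower interval, so this sequence is
[j]-eth-Morley.  At [j = k] the interval contains [[1, n]].  The second part is the case
[n = N] for the theory of a countable generic space. *)

Set Implicit Arguments.
Unset Strict Implicit.
Unset Printing Implicit Defensive.

Local Open Scope classical_set_scope.

(** * Formulas *)

Fixpoint fv (L : language) (V : Type) (p : formula L V) : seq V :=
  match p with
  | Bot => [::]
  | Equal x y => [:: x; y]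
  | Rel r t => tval t
  | Imp p q => fv p ++ fv q
  | All p => pmap id (fv p)
  end.

Definition Ex L V (p : formula L (option V)) : formula L V :=
  Neg (All (Neg p)).

(** The negation of [F i -> F j -> ... -> Bot], classically a conjunction. *)
Definition Conj L V (I : finType) (F : I -> formula L V) : formula L V :=
  Neg (foldr Imp Bot [seq F i | i <- enum I]).

Lemma sat_Ex L (U : structure L) V (s : V -> U) (p : formula L (option V)) :
  sat s (Ex p) <-> exists u : U, sat (fun v => oapp s u v) p.
Proof.
split=> [H|[u Hu] H]; last exact: H Hu.
by apply: contrapT => N; apply: H => u Hu; apply: N; exists u.
Qed.

Lemma sat_Conj L (U : structure L) V (I : finType) (s : V -> U)
    (F : I -> formula L V) :
  sat s (Conj F) <-> forall i, sat s (F i).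
Proof.
have foldP (l : seq I) : sat s (foldr Imp Bot [seq F i | i <- l]) <->
    ~ forall i, i \in l -> sat s (F i).
  elim: l => [|j l IH] /=; first by split=> [[]|]; apply.
  split=> [H N|H Hj].
    have /IH[] := H (N j (mem_head _ _)).
    by move=> i il; apply: N; rewrite in_cons il orbT.
  apply/IH => N; apply: H => i; rewrite in_cons => /orP[/eqP->//|]; exact: N.
split=> [H i|H /foldP N]; last by apply: N => i _; exact: H.
apply: contrapT => N; apply: H; apply/foldP => /(_ i) Hi.
by apply: N; apply: Hi; rewrite mem_enum.
Qed.

Lemma sat_bigOr L (U : structure L) V n (s : V -> U)
    (F : 'I_n -> formula L V) :
  sat s (\big[@Or _ _/Bot]_(r < n) F r) <-> exists r, sat s (F r).
Proof.
have bigP (l : seq 'I_n) : sat s (\big[@Or _ _/Bot]_(r <- l) F r) <->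
    exists2 r, r \in l & sat s (F r).
  elim: l => [|j l IH]; first by rewrite big_nil; split=> [[]|[]].
  rewrite big_cons; split=> /= [H|[r]].
    have [Hj|Hj] := EM (sat s (F j)); first by exists j; rewrite ?mem_head.
    by have /IH[r rl Hr] := H Hj; exists r; rewrite // in_cons rl orbT.
  rewrite in_cons => /orP[/eqP->//|rl Hr _]; apply/IH; by exists r.
split=> [/bigP[r _ ?]|[r Hr]]; first by exists r.
by apply/bigP; exists r; rewrite ?mem_index_enum.
Qed.

(* [opts m] is [option (... (option void))], so that [m] universal quantifiers
   close a formula with variables in [opts m]. *)
Fixpoint opts (m : nat) : finType :=
  if m is m'.+1 then option (opts m') else void.

Lemma card_opts m : #|opts m| = m.
Proof. by elim: m => [|m IH]; rewrite /= ?card_void ?card_option ?IH. Qed.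

Fixpoint all_closure L m : formula L (opts m) -> sentence L :=
  match m with
  | 0 => id
  | m'.+1 => fun p => all_closure (All p : formula L (opts m'))
  end.

Lemma holds_all_closure L (U : structure L) m (p : formula L (opts m)) :
  holds U (all_closure p) <-> forall s : opts m -> U, sat s p.
Proof.
elim: m p => [|m IH] p /=.
  split=> [H s|]; last exact.
  by rewrite (_ : s = of_void U) //; apply: funext; case.
rewrite IH; split=> [H s|H s u]; last exact: H.
by have := H (s \o Some) (s None); congr sat; apply: funext; case.
Qed.

(** * Bounded metric spaces *)

Record metric (n : nat) (T : Type) (d : T -> T -> nat) : Prop := Metric {
  distxx : forall x, d x x = 0;
  dist0_eq : forall x y, d x y = 0 -> x = y;
  distC : forall x y, d x y = d y x;
  distT : forall x y z, d x z <= d x y + d y z;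
  dist_le : forall x y, d x y <= n }.

(* [f] is the distance function from a (possibly new) point to the [s i] *)
Definition katetov n T (d : T -> T -> nat) I (s : I -> T) (f : I -> nat) :=
  (forall i, f i <= n) /\
  forall i j, f i <= f j + d (s i) (s j) /\ d (s i) (s j) <= f i + f j.

Definition generic n T (d : T -> T -> nat) :=
  metric n d /\ forall m (s : 'I_m -> T) f, katetov n d s f ->
    exists u, forall i, d u (s i) = f i.

(** For Katetov [f], the largest Katetov function with values [f i] at the [s i]: shortest paths
    through some [s i], cut off at [n]. *)
Definition shortest n T (d : T -> T -> nat) (I : finType) (s : I -> T)
    (f : I -> nat) (x : T) :=
  \big[minn/n]_(i : I) (f i + d (s i) x).

Lemma leq_bigmin (I : finType) n (F : I -> nat) z :
  z <= \big[minn/n]_i F i <-> z <= n /\ forall i, z <= F i.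
Proof.
have bigP (l : seq I) : z <= \big[minn/n]_(i <- l) F i <->
    z <= n /\ forall i, i \in l -> z <= F i.
  elim: l => [|j l IH]; first by rewrite big_nil; split=> [|[]].
  rewrite big_cons leq_min; split=> [/andP[zj /IH[zn zl]]|[zn zl]].
    by split=> // i; rewrite in_cons => /orP[/eqP->//|]; exact: zl.
  rewrite zl ?mem_head //=; apply/IH; split=> // i il.
  by apply: zl; rewrite in_cons il orbT.
rewrite bigP; split=> [[zn H]|[zn H]]; split=> // i.
  by apply: H; rewrite mem_index_enum.
Qed.

Lemma shortest_katetov n T (d : T -> T -> nat) (I : finType) (s : I -> T) f :
  metric n d -> katetov n d s f ->
  katetov n d id (shortest n d s f) /\
  forall i, shortest n d s f (s i) = f i.
Proof.
move=> md [fn fd]; set g := shortest n d s f.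
have gle x : g x <= n /\ forall i, g x <= f i + d (s i) x by exact/leq_bigmin.
have geg x z : z <= n -> (forall i, z <= f i + d (s i) x) -> z <= g x.
  by move=> zn zi; apply/leq_bigmin.
split; last first.
  move=> i; apply/eqP; rewrite eqn_leq; apply/andP; split.
    by have [_ /(_ i)] := gle (s i); rewrite (distxx md) addn0.
  by apply/geg => // j; have [] := fd i j; rewrite (distC md (s i)).
split=> [x|x y]; first by have [] := gle x.
split.
  have [gx gxi] := gle x.
  suff: g x - d x y <= g y by lia.
  apply/geg => [|i]; first by lia.
  by have := gxi i; have := distT md (s i) y x; rewrite (distC md y x); lia.
have := dist_le md x y => dn.
suff: d x y - g x <= g y by lia.
apply/geg => [|i]; first by lia.
suff: d x y - f i - d (s i) y <= g x by lia.
apply/geg => [|j]; first by lia.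
have := distT md x (s j) y; have := distT md (s j) (s i) y.
have [_] := fd i j; rewrite (distC md x (s j)) (distC md (s i) (s j)); lia.
Qed.

(** Variables form an arbitrary type without decidable equality, hence [List.In] in place of
    [\in]. *)
Lemma seqIn_tnth V (l : seq V) v :
  List.In v l -> exists i, tnth (in_tuple l) i = v.
Proof.
elim: l => //= w l IH [->|/IH[i <-]]; first by exists ord0.
by exists (lift ord0 i); rewrite !(tnth_nth v).
Qed.

Lemma In_tnth V m (t : m.-tuple V) i : List.In (tnth t i) t.
Proof.
rewrite (tnth_nth (tnth t i)); move: (tnth _ _) => x0.
case: i => i /=; rewrite -[X in i < X](size_tuple t).
elim: (tval t) i => //= v l IH [|i] /=; first by left.
by rewrite ltnS => il; right; apply: IH.
Qed.

Lemma generic_seq n T (d : T -> T -> nat) V (l : seq V) (s : V -> T)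
    (f : V -> nat) :
  generic n d ->
  (forall v w, List.In v l -> List.In w l -> [/\ f v <= n,
     f v <= f w + d (s v) (s w) & d (s v) (s w) <= f v + f w]) ->
  exists u, forall v, List.In v l -> d u (s v) = f v.
Proof.
move=> [_ ext] H; set t := tnth (in_tuple l).
have [|u Hu] := ext _ (s \o t) (f \o t).
  split=> [i|i j].
    by have [] := H _ _ (In_tnth (in_tuple l) i) (In_tnth (in_tuple l) i).
  by have [] := H _ _ (In_tnth (in_tuple l) i) (In_tnth (in_tuple l) j).
by exists u => v vl; have [i <-] := seqIn_tnth vl; exact: Hu.
Qed.

(** * Quantifier elimination *)

Definition measures n (U : structure (metric_language n)) (d : U -> U -> nat) :=
  forall (r : 'I_n.+1) x y,
    @interp (metric_language n) U r [tuple x; y] <-> d x y = r.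
Arguments measures n {U} d.

Lemma tuple2E V (t : 2.-tuple V) :
  t = [tuple tnth t ord0; tnth t (lift ord0 ord0)].
Proof.
case/tupleP: t => x t; case/tupleP: t => y t; rewrite (tuple0 t).
by apply: val_inj; rewrite /= !(tnth_nth x).
Qed.

Lemma sat_Rel n (U : structure (metric_language n)) d V (s : V -> U)
    (r : 'I_n.+1) (t : 2.-tuple V) :
  measures n d ->
  sat s (@Rel (metric_language n) V r t) <->
    d (s (tnth t ord0)) (s (tnth t (lift ord0 ord0))) = r.
Proof.
move=> md; rewrite -(md r).
suff <- : [tuple of map s t] =
    [tuple s (tnth t ord0); s (tnth t (lift ord0 ord0))] by [].
by rewrite [LHS]tuple2E !tnth_map.
Qed.

Lemma sat_Dist n (U : structure (metric_language n)) d V (s : V -> U) r x y :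
  measures n d -> sat s (Dist r x y) <-> d (s x) (s y) = r.
Proof. exact: sat_Rel. Qed.

Lemma In_cat V (l l' : seq V) v :
  List.In v (l ++ l') <-> List.In v l \/ List.In v l'.
Proof. exact: List.in_app_iff. Qed.

Lemma In_pmap_id V (l : seq (option V)) v :
  List.In v (pmap id l) <-> List.In (Some v) l.
Proof.
elim: l => //= -[w|] l <- /=; last by split=> [|[]//]; right.
by split=> -[[->]|]; by [left|right].
Qed.

(** Back and forth: only the finitely many free variables of [p] matter, so at a quantifier
    genericity answers a point of one space by a point of the other. *)
Lemma sat_isometry n (U U' : structure (metric_language n)) d d' V
    (p : formula (metric_language n) V) (s : V -> U) (s' : V -> U') :
  measures n d -> measures n d' -> generic n d -> generic n d' ->
  (forall v w, List.In v (fv p) -> List.In w (fv p) ->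
     d (s v) (s w) = d' (s' v) (s' w)) ->
  sat s p <-> sat s' p.
Proof.
move=> md md' gd gd'; have [[Md _] [Md' _]] := (gd, gd').
elim: p s s' => {V} [V|V x y|V r t|V p IHp q IHq|V p IHp] s s' H.
- by [].
- have := H x y; rewrite /=; have [d0 d0'] := (distxx Md, distxx Md').
  move=> /(_ (or_introl erefl) (or_intror (or_introl erefl))) E.
  split=> e; first by apply: (dist0_eq Md'); rewrite -E e.
  by apply: (dist0_eq Md); rewrite E e.
- rewrite !(sat_Rel _ _ _ md) !(sat_Rel _ _ _ md') H //.
    exact: In_tnth.
  exact: In_tnth.
- have Hp := IHp s s'; have Hq := IHq s s'.
  have {}Hp : sat s p <-> sat s' p.
    by apply: Hp => v w vp wp; apply: H; apply/In_cat; left.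
  have {}Hq : sat s q <-> sat s' q.
    by apply: Hq => v w vp wp; apply: H; apply/In_cat; right.
  by rewrite /= Hp Hq.
- have transfer u u' :
      (forall v, List.In v (pmap id (fv p)) -> d u (s v) = d' u' (s' v)) ->
      (sat (fun v => oapp s u v) p <-> sat (fun v => oapp s' u' v) p).
    move=> E; apply: IHp => -[v|] [w|] vp wp /=.
    - by apply: H; apply/In_pmap_id.
    - by rewrite (distC Md) (distC Md'); apply: E; apply/In_pmap_id.
    - by apply: E; apply/In_pmap_id.
    - by rewrite (distxx Md) (distxx Md').
  split=> /= Hs u.
    have [v w vp wp|u' Hu] := @generic_seq n U d V (pmap id (fv p)) s
      (fun v => d' u (s' v)) gd.
      rewrite H // (dist_le Md') (distC Md' (s' v) (s' w)) (distT Md').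
      by rewrite (distC Md' u (s' v)) (distC Md' (s' w)) (distT Md').
    exact: (iffLR (transfer u' u Hu) (Hs u')).
  have [v w vp wp|u' Hu] := @generic_seq n U' d' V (pmap id (fv p)) s'
      (fun v => d u (s v)) gd'.
    rewrite -H // (dist_le Md) (distC Md (s v) (s w)) (distT Md).
    by rewrite (distC Md u (s v)) (distC Md (s w)) (distT Md).
  apply: (iffRL (transfer u u' _) (Hs u')) => v vp.
  by rewrite Hu.
Qed.

(** * Models of the theory of metric spaces *)

Definition metric_structure n W (d : W -> W -> nat) :
    structure (metric_language n) :=
  @Structure (metric_language n) W
    (fun r t => d (tnth t ord0) (tnth t (lift ord0 ord0)) = r).

Lemma metric_structure_measures n W (d : W -> W -> nat) :
  measures n (d : metric_structure n d -> _).
Proof. by move=> r x y; rewrite /= !(tnth_nth x). Qed.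

Lemma sat_DistE n (U : structure (metric_language n)) V (s : V -> U) r x y :
  sat s (Dist r x y) <-> @interp (metric_language n) U r [tuple s x; s y].
Proof.
suff <- : [tuple of map s [tuple x; y]] = [tuple s x; s y] by [].
exact: val_inj.
Qed.

Lemma metric_model n (U : structure (metric_language n)) (d : U -> U -> nat) :
  measures n d -> metric n d -> inhabited U -> model (metric_theory n) U.
Proof.
move=> md Md iU; split=> // p; case=> {p} [|r s rs||||r s t rst].
- move=> u v; apply/sat_bigOr; have lt := dist_le Md u v.
  by exists (Ordinal (lt : d u v < n.+1)); apply/(sat_Dist _ _ _ _ md).
- move=> u v /(sat_Dist _ _ _ _ md) dr /(sat_Dist _ _ _ _ md) ds.
  by move/eqP: rs; apply; apply: ord_inj; rewrite -dr -ds.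
- by move=> u; apply/(sat_Dist _ _ _ _ md); rewrite /= (distxx Md).
- by move=> u v /(sat_Dist _ _ _ _ md) /(dist0_eq Md).
- move=> r u v /(sat_Dist _ _ _ _ md) dr; apply/(sat_Dist _ _ _ _ md).
  by rewrite (distC Md).
- move=> u v w /(sat_Dist _ _ _ _ md) /= dr /(sat_Dist _ _ _ _ md) /= ds
    /(sat_Dist _ _ _ _ md) /= dt.
  by have := distT Md u v w; lia.
Qed.

Lemma model_metric n (U : structure (metric_language n)) :
  model (metric_theory n) U -> exists d, measures n (d : U -> U -> nat) /\ metric n d.
Proof.
move=> [_ ax].
have ex x y : exists r : 'I_n.+1,
    @interp (metric_language n) U r [tuple x; y].
  have /= /(_ x y) /sat_bigOr[r] := ax _ (metric_total n).
  by move/sat_DistE; exists r.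
have uniq (r s : 'I_n.+1) x y : @interp (metric_language n) U r [tuple x; y] ->
    @interp (metric_language n) U s [tuple x; y] -> r = s.
  move=> Ir Is; apply/eqP/negP => /negP rs.
  have := ax _ (metric_unique rs); move=> /(_ x y) H.
  by apply: H; apply/sat_DistE.
pose S x y := [set r : 'I_n.+1 | @interp (metric_language n) U r [tuple x; y]].
pose d x y : nat := xget ord0 (S x y).
have dP x y : exists2 r : 'I_n.+1, d x y = r &
    @interp (metric_language n) U r [tuple x; y].
  have [r ir] := ex x y.
  by exists (xget ord0 (S x y)) => //; exact: (xgetPex ord0 (ex x y)).
have md : measures n d.
  move=> r x y; have [s -> Is] := dP x y; split=> [ir|/val_inj <-//].
  by rewrite (uniq _ _ _ _ ir Is).
exists d; split=> //; split=> [x|x y|x y|x y z|x y].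
- exact: (iffLR (sat_Dist _ _ _ _ md) (ax _ (metric_refl n) x)).
- move=> d0; have := ax _ (metric_sep n); move=> /(_ x y); apply.
  by apply/(sat_Dist _ _ _ _ md).
- have [r dr _] := dP x y; rewrite dr; pose s : option (option void) -> U :=
    fun v => oapp (fun v => oapp (of_void U) x v) y v.
  have H : sat s (Dist r (Some None) None) -> sat s (Dist r None (Some None)) :=
    ax _ (metric_sym r) x y.
  exact/esym/(sat_Dist s r None (Some None) md)/H/sat_Dist.
- have [r dr _] := dP x y; have [s ds _] := dP y z; have [t dt _] := dP x z.
  rewrite dr ds dt leqNgt; apply/negP => lt.
  pose s3 : option (option (option void)) -> U :=
    fun v => oapp (fun v => oapp (fun v => oapp (of_void U) x v) y v) z v.
  have H : sat s3 (Dist r (Some (Some None)) (Some None)) ->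
      sat s3 (Dist s (Some None) None) ->
      ~ sat s3 (Dist t (Some (Some None)) None) :=
    ax _ (metric_triangle lt) x y z.
  by apply: H; apply/(sat_Dist _ _ _ _ md).
- by have [r -> _] := dP x y; rewrite -ltnS.
Qed.

(** * The extension property *)

Definition extension n (V : finType) (f : V -> nat) :
    formula (metric_language n) V :=
  Ex (Conj (fun i : V => Dist (inord (f i)) None (Some i))).

Lemma sat_extension n (U : structure (metric_language n)) (d : U -> U -> nat)
    (V : finType) (f : V -> nat) (s : V -> U) :
  measures n d -> (forall v, f v <= n) ->
  sat s (extension n f) <-> exists u, forall v, d u (s v) = f v.
Proof.
move=> md fn; rewrite sat_Ex; split=> -[u Hu]; exists u.
  move=> v; have /(_ v) Hv := iffLR (sat_Conj _ _) Hu.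
  have := iffLR (sat_Dist _ _ _ _ md) Hv; by rewrite /= inordK // ltnS.
by apply/sat_Conj => v; apply/(sat_Dist _ _ _ _ md); rewrite /= inordK ?Hu // ltnS.
Qed.

Lemma interpE n (U : structure (metric_language n)) (d : U -> U -> nat)
    (r : 'I_n.+1) (t : 2.-tuple U) :
  measures n d -> @interp (metric_language n) U r t <->
    d (tnth t ord0) (tnth t (lift ord0 ord0)) = r.
Proof. by move=> md; rewrite -(md r) -tuple2E. Qed.

Lemma isometry_embedding n (U U' : structure (metric_language n))
    (d : U -> U -> nat) (d' : U' -> U' -> nat) (f : U -> U') :
  measures n d -> measures n d' -> metric n d -> metric n d' ->
  (forall x y, d' (f x) (f y) = d x y) -> embedding f.
Proof.
move=> md md' Md Md' df; split=> [x y fxy|r t].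
  by apply: (dist0_eq Md); rewrite -df fxy (distxx Md').
by rewrite (interpE _ _ md) (interpE _ _ md') !tnth_map df.
Qed.

Lemma embedding_isometry n (U U' : structure (metric_language n))
    (d : U -> U -> nat) (d' : U' -> U' -> nat) (f : U -> U') :
  measures n d -> measures n d' -> metric n d -> embedding f ->
  forall x y, d' (f x) (f y) = d x y.
Proof.
move=> md md' Md [_ ef] x y; have lt : d x y < n.+1 := dist_le Md x y.
have := ef (Ordinal lt) [tuple x; y].
rewrite (interpE _ _ md) (interpE _ _ md') !tnth_map /= => -[+ _]; exact.
Qed.

Definition add_point T (d : T -> T -> nat) (g : T -> nat) (x y : option T) :=
  match x, y with
  | Some x, Some y => d x y
  | Some x, None | None, Some x => g x
  | None, None => 0
  end.

Lemma add_point_metric n T (d : T -> T -> nat) g :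
  metric n d -> katetov n d id g -> (forall x, 0 < g x) ->
  metric n (add_point d g).
Proof.
move=> Md [gn gd] gp; have d0 := distxx Md.
split=> [[x|]|[x|] [y|]|[x|] [y|]|[x|] [y|] [z|]|[x|] [y|]] //=.
- by move/(dist0_eq Md) ->.
- by move=> g0; have := gp x; rewrite g0.
- by move=> g0; have := gp y; rewrite g0.
- exact: distC Md x y.
- exact: distT Md x y z.
- by rewrite addnC; have [] := gd x y.
- by have [] := gd x z.
- by rewrite addn0.
- by rewrite (distC Md); have [] := gd z y.
- exact: dist_le Md x y.
Qed.

(** A model of [T] embeds in a metric space, whose distance is pulled back. *)
Lemma companion_metric n T (U : structure (metric_language n)) :
  model_companion T (metric_theory n) -> model T U ->
  exists d : U -> U -> nat, measures n d /\ metric n d.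
Proof.
move=> [_ emb _] /emb[A [/model_metric[dA [mA MA]] [f [injf ef]]]].
exists (fun x y => dA (f x) (f y)); split.
  move=> r x y; rewrite -[_ = _](interpE r [tuple f x; f y] mA) ef.
  by rewrite !(interpE _ _ mA) !tnth_map.
split=> [x|x y /(dist0_eq MA) /injf //|x y|x y z|x y].
- exact: distxx MA _.
- exact: distC MA _ _.
- exact: distT MA _ _ _.
- exact: dist_le MA _ _.
Qed.

(* A point realizing [f] is added to [U] by shortest paths; the resulting space
   embeds in a model of [T], and the embedding of [U] there is elementary. *)
Lemma companion_generic n T (U : structure (metric_language n)) :
  model_companion T (metric_theory n) -> model T U ->
  exists d : U -> U -> nat, measures n d /\ generic n d.
Proof.
move=> TC TU; have [d [md Md]] := companion_metric TC TU.
exists d; split=> //; split=> // m s f Kf; have [fn fd] := Kf.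
have [[u0] _] := TU.
have [n0|n_gt0] := posnP n.
  by exists u0 => i; have := dist_le Md u0 (s i); have := fn i; lia.
(* A zero value is realized by the old point [s i]; otherwise the new point is distinct from all old
   ones. *)
have [[i fi]|fpos] := EM (exists i, f i = 0).
  by exists (s i) => j; have [] := fd i j; have [] := fd j i;
    rewrite (distC Md (s j)); lia.
have [Kg gs] := shortest_katetov Md Kf.
set g := shortest n d s f in Kg gs.
have gpos x : 0 < g x.
  apply/leq_bigmin; split=> // i; rewrite addn_gt0 lt0n.
  by apply/orP; left; apply/eqP => fi; apply: fpos; exists i.
have MW := add_point_metric Md Kg gpos.
have mW := @metric_structure_measures n _ (add_point d g).
have [emb _ mc] := TC.
have [B [TB [h eh]]] := emb _ (metric_model mW MW (inhabits None)).
have [dB [mB MB]] := companion_metric TC TB.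
have hd := embedding_isometry mW mB MW eh.
have eU : embedding (h \o Some).
  by apply: (isometry_embedding md mB Md MB) => x y; exact: hd.
apply/(sat_extension _ md fn)/(mc _ _ TU TB _ eU).
by apply/(sat_extension _ mB fn); exists (h None) => i; rewrite /= hd /= gs.
Qed.

(** * A countable generic metric space *)

Lemma metric_preim n T W (d : W -> W -> nat) (h : T -> W) :
  metric n d -> injective h -> metric n (fun x y => d (h x) (h y)).
Proof.
move=> Md injh; split=> [x|x y /(dist0_eq Md) /injh //|x y|x y z|x y].
- exact: distxx Md _.
- exact: distC Md _ _.
- exact: distT Md _ _ _.
- exact: dist_le Md _ _.
Qed.

Lemma injective_unbounded (h : nat -> nat) B :
  injective h -> exists k, B <= h k.
Proof.
move=> injh; apply: contrapT => N.
have : uniq [seq h k | k <- iota 0 B.+1] by rewrite map_inj_uniq ?iota_uniq.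
move=> /uniq_leq_size -/(_ (iota 0 B)).
rewrite size_map !size_iota ltnn => /(_ _)/wrap[]//.
move=> _ /mapP[k _ ->]; rewrite mem_iota add0n leq0n /= ltnNge.
by apply/negP => Bk; apply: N; exists k.
Qed.

Section CountableGeneric.
Variable n : nat.

(* [(x, r) \in l] prescribes the distance [r] to the point [x] *)
Let pt (l : seq (nat * nat)) (i : 'I_(size l)) := (tnth (in_tuple l) i).1.
Let dst (l : seq (nat * nat)) (i : 'I_(size l)) := (tnth (in_tuple l) i).2.
Arguments pt : clear implicits.
Arguments dst : clear implicits.

Definition valid_task (d : nat -> nat -> nat) N (l : seq (nat * nat)) :=
  (forall i, pt l i < N /\ 0 < dst l i) /\ katetov n d (pt l) (dst l).

(** The point [N] becomes the new point of [add_point]; its former distances are discarded. *)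
Definition replace_point (d : nat -> nat -> nat) N (g : nat -> nat) a b :=
  let h a := if a == N then None else Some a in add_point d g (h a) (h b).

(** [N] is read as the code of a task paired with a dummy number, so that every task has arbitrarily
    large codes. *)
Definition stage_step N (d : nat -> nat -> nat) : nat -> nat -> nat :=
  if @unpickle (seq (nat * nat) * nat)%type N is Some (l, _) then
    if `[< valid_task d N l >] then
      replace_point d N (shortest n d (pt l) (dst l))
    else d
  else d.

(* In [stage N], the points from [N] on are at distance [n] from every other
   point. *)
Fixpoint stage N : nat -> nat -> nat :=
  if N is N'.+1 then stage_step N' (stage N')
  else fun a b => if a == b then 0 else n.

(** Step [N] changes distances to the point [N] only, so this value is final. *)
Definition limit_dist a b := stage (maxn a b).+1 a b.

Hypothesis n_gt0 : 0 < n.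

Lemma stageP N : metric n (stage N) /\
  forall a b, a != b -> N <= maxn a b -> stage N a b = n.
Proof.
elim: N => [|N [Md far]].
  split=> [|a b ab _] /=; last by rewrite (negbTE ab).
  split=> [x|x y|x y|x y z|x y].
  - by rewrite eqxx.
  - by case: eqP => // _ n0; move: (n_gt0); rewrite n0.
  - by rewrite eq_sym.
  - have [//|xz] := eqVneq x z; have [<-|_] := eqVneq x y.
      by rewrite (negbTE xz).
    exact: leq_addr.
  - by case: eqP.
rewrite /= /stage_step; case: unpickle => [[l _]|]; last first.
  by split=> // a b ab Nab; apply: far => //; exact: ltnW.
case: asboolP => [[lt_gt0 Kv]|_]; last first.
  by split=> // a b ab Nab; apply: far => //; exact: ltnW.
have [Kg gv] := shortest_katetov Md Kv; set g := shortest _ _ _ _ in Kg gv *.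
have g_gt0 x : 0 < g x.
  apply/leq_bigmin; split=> // i; rewrite addn_gt0.
  by have [_ ->] := lt_gt0 i.
(* Every prescribed point is at distance [n] from [a], so only the cutoff remains in the minimum. *)
have g_far a : N < a -> g a = n.
  move=> Na; apply/eqP; rewrite eqn_leq; have [-> _] := Kg.
  apply/leq_bigmin; split=> // i; have [iN _] := lt_gt0 i.
  by rewrite far ?leq_addl //; lia.
split.
  apply: (@metric_preim n nat _ (add_point (stage N) g)
    (fun a => if a == N then None else Some a)).
    exact: add_point_metric.
  move=> a b; do 2 case: eqP => //; first by move=> -> ->.
  by move=> _ _ [].
move=> a b ab Nab; rewrite /replace_point.
have [aN|aN] := eqVneq a N; have [bN|bN] := eqVneq b N => /=.
- by rewrite aN bN eqxx in ab.
- by apply: g_far; lia.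
- by apply: g_far; lia.
- by apply: far => //; exact: ltnW.
Qed.

Lemma stage_limit N a b : maxn a b < N -> stage N a b = limit_dist a b.
Proof.
elim: N => // N IH; rewrite ltnS leq_eqVlt => /orP[/eqP <-//|lt].
rewrite -IH //= /stage_step; case: unpickle => [[l _]|//].
case: asboolP => // _; rewrite /replace_point.
by have [aN|_] := eqVneq a N; have [bN|_] := eqVneq b N => //; lia.
Qed.

Lemma limit_dist_generic : generic n limit_dist.
Proof.
have Md N := proj1 (stageP N).
have Ml : metric n limit_dist.
  split=> [x|x y|x y|x y z|x y].
  - exact: distxx (Md _) x.
  - exact: dist0_eq (Md _) x y.
  - by rewrite /limit_dist maxnC (distC (Md _)).
  - pose N := (maxn x (maxn y z)).+1.
    rewrite -!(@stage_limit N) /N; [exact: distT (Md _) x y z|lia..].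
  - exact: dist_le (Md _) x y.
split=> // m s f [fn fd].
have [[i fi]|fpos] := EM (exists i, f i = 0).
  by exists (s i) => j; have [] := fd i j; have [] := fd j i;
    rewrite (distC Ml (s j)); lia.
pose l := [seq (s i, f i) | i <- enum 'I_m].
have lP j : exists i, tnth (in_tuple l) j = (s i, f i).
  by have /mapP[i _ ->] := mem_tnth j (in_tuple l); exists i.
(* Padding makes the code [N] exceed every point of the task. Stage [N] then shows their final
   distances, and step [N] turns the point [N] into a realization. *)
have [pad padP] := @injective_unbounded (fun k => pickle (l, k))
  (\max_i s i).+1 (fun k k' => fun e => congr1 snd (pcan_inj pickleK e)).
set N := pickle _ in padP.
have sN i : s i < N by apply: leq_trans padP; rewrite ltnS leq_bigmax.
have sd i j : stage N (s i) (s j) = limit_dist (s i) (s j).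
  by rewrite stage_limit // gtn_max !sN.
have vl : valid_task (stage N) N l.
  split=> [j|].
    rewrite /pt /dst; have [i -> /=] := lP j; split=> //.
    by rewrite lt0n; apply/eqP => fi; apply: fpos; exists i.
  split=> [j|j j']; rewrite /pt /dst; have [i -> /=] := lP j; first exact: fn.
  by have [i' -> /=] := lP j'; rewrite sd.
exists N => i; rewrite -(@stage_limit N.+1); last by rewrite gtn_max ltnS leqnn ltnS ltnW.
rewrite /= /stage_step /N pickleK -/N; case: asboolP => // _.
rewrite /replace_point eqxx ltn_eqF ?sN //=.
have [_ gs] := shortest_katetov (Md N) (proj2 vl).
have /tnthP[j jE] : (s i, f i) \in in_tuple l by rewrite map_f // mem_enum.
by have := gs j; rewrite /pt /dst -jE.
Qed.

End CountableGeneric.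

(** * Realizing countable configurations *)

(* [e] and [D] extend the distance on the [t j] to a pseudometric on the
   disjoint union of [J] and [Z]. *)
Record amalgam n T (d : T -> T -> nat) J (t : J -> T) Z (e : Z -> J -> nat)
    (D : Z -> Z -> nat) : Prop := Amalgam {
  amalgam_katetov : forall z, katetov n d t (e z);
  amalgam_lip : forall z z' j, e z j <= D z z' + e z' j;
  amalgam_sum : forall z z' j, D z z' <= e z j + e z' j;
  amalgam0 : forall z, D z z = 0;
  amalgamC : forall z z', D z z' = D z' z;
  amalgamT : forall x y z, D x z <= D x y + D y z;
  amalgam_le : forall z z', D z z' <= n }.

(** Genericity over a possibly infinite family [t] and finitely many further points. It comes from
    genericity for finite [J] and from saturation for small [J]. *)
Definition extends_over n T (d : T -> T -> nat) J (t : J -> T) :=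
  forall m (s : 'I_m -> T) (f : J + 'I_m -> nat), katetov n d (join t s) f ->
    exists u, forall j, d u (join t s j) = f j.

Section Realize.
Variables (n : nat) (T : Type) (d : T -> T -> nat) (J : Type) (t : J -> T).
Variables (Z : countType) (e : Z -> J -> nat) (D : Z -> Z -> nat).
Hypotheses (Md : metric n d) (ext : extends_over n d t).
Hypothesis eD : amalgam n d t e D.

Let correct i (s : Z -> T) :=
  (forall z j, pickle z < i -> d (s z) (t j) = e z j) /\
  (forall z z', pickle z < i -> pickle z' < i -> d (s z) (s z') = D z z').

(** Points of [Z] are placed in the order of their codes. By the amalgam axioms the distances
    required of the next point form a Katetov function over [t] and the points already placed. *)
Lemma realize_next i (s : Z -> T) : correct i s ->
  exists s', correct i.+1 s' /\ forall z, pickle z < i -> s' z = s z.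
Proof.
move=> [st ss]; have [[z0 z0i]|N] := EM (exists z : Z, pickle z = i); last first.
  have lt (z : Z) : pickle z < i.+1 -> pickle z < i.
    by rewrite ltnS leq_eqVlt => /orP[/eqP zi|//]; case: N; exists z.
  exists s; split=> //; split=> [z j|z z'] /lt ?; first exact: st.
  by move/lt; exact: ss.
pose l := pmap (@pickle_inv Z) (iota 0 i).
have lP z : pickle z < i -> z \in l.
  move=> zi; rewrite mem_pmap; apply/mapP; exists (pickle z).
    by rewrite mem_iota.
  by rewrite pickleK_inv.
have li k : pickle (tnth (in_tuple l) k) < i.
  have := mem_tnth k (in_tuple l); rewrite mem_pmap => /mapP[c].
  rewrite mem_iota /= add0n => ci E.
  by have := @pickle_invK Z c; rewrite -E /= => ->.
pose f (x : J + 'I_(size l)) :=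
  match x with inl j => e z0 j | inr k => D z0 (tnth (in_tuple l) k) end.
have [|u Hu] := ext (s := s \o tnth (in_tuple l)) (f := f).
  have [e_le e_d] := amalgam_katetov eD z0.
  split=> [[j|k]|[j|k] [j'|k']] /=.
  - exact: e_le.
  - exact: amalgam_le eD _ _.
  - exact: e_d.
  - rewrite (distC Md) st //; set z := tnth _ _.
    have := amalgam_lip eD z0 z j; have := amalgam_lip eD z z0 j.
    by have := amalgamC eD z z0; lia.
  - rewrite st //; set z := tnth _ _.
    have := amalgam_sum eD z0 z j'; have := amalgam_lip eD z z0 j'.
    by have := amalgamC eD z z0; lia.
  - rewrite ss //; set z := tnth _ _; set z' := tnth _ _.
    have := amalgamT eD z0 z' z; have := amalgamT eD z z0 z'.
    by have := amalgamC eD z z'; have := amalgamC eD z z0; lia.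
exists (fun z => if z == z0 then u else s z).
have ut j : d u (t j) = e z0 j := Hu (inl j).
have us z : pickle z < i -> d u (s z) = D z0 z.
  by move=> /lP /(tnthP (in_tuple l))[k ->]; exact: (Hu (inr k)).
have lt (z : Z) : pickle z < i.+1 -> z != z0 -> pickle z < i.
  by rewrite ltnS leq_eqVlt -z0i => /orP[/eqP /(pcan_inj pickleK) ->|//];
    rewrite eqxx.
split=> [|z zi]; last by case: eqP => // zz0; rewrite zz0 z0i ltnn in zi.
split=> [z j zi|z z' zi zi'].
  by have [->|/(lt _ zi) ?] := eqVneq z z0; [exact: ut | exact: st].
have [->|/(lt _ zi) {}zi] := eqVneq z z0;
    have [->|/(lt _ zi') {}zi'] := eqVneq z' z0.
- by rewrite (distxx Md) (amalgam0 eD).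
- exact: us.
- by rewrite (distC Md) (amalgamC eD) us.
- exact: ss.
Qed.

Lemma realize : exists s : Z -> T,
  (forall z j, d (s z) (t j) = e z j) /\ forall z z', d (s z) (s z') = D z z'.
Proof.
have [[z0 _]|N] := EM (exists z : Z, True); last first.
  have F (z : Z) : False by apply: N; exists z.
  by exists (fun z => False_rect T (F z)); split=> z; case: (F z).
have [e_le e_d] := amalgam_katetov eD z0.
(* The construction needs some point of [T] as initial value; extending [t] alone supplies one. *)
have [|u0 _] := @ext 0 (fun i => False_rect T (ltac:(by case: i) : False))
  (fun x => match x with inl j => e z0 j | inr _ => 0 end).
  by split=> [[j|[]]|[j|[]] // [j'|[]] //] //.
have base : correct 0 (fun=> u0) by split=> z ?; rewrite ltn0.
pose next i (s : {s | correct i s}) : {s' | correct i.+1 s' /\ forall z,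
  pickle z < i -> s' z = sval s z} := cid (realize_next (svalP s)).
pose seqs := nat_rect (fun i => {s | correct i s}) (exist _ (fun=> u0) base)
  (fun i s => exist _ (sval (next i s)) (proj1 (svalP (next i s)))).
have stable i k z : pickle z < i -> sval (seqs (i + k)) z = sval (seqs i) z.
  move=> zi; elim: k => [|k IH]; first by rewrite addn0.
  rewrite addnS -IH /=; case: (next _ _) => s' [_ E] /=.
  by apply: E; exact: leq_trans zi (leq_addr _ _).
exists (fun z => sval (seqs (pickle z).+1) z); split=> [z j|z z'].
  by have [st _] := svalP (seqs (pickle z).+1); apply: st.
pose m := maxn (pickle z) (pickle z').
rewrite -(stable _ (m - pickle z)) // -(stable _ (m - pickle z') z') //.
rewrite !addSn !subnKC ?leq_maxl ?leq_maxr //.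
by have [_ ss] := svalP (seqs m.+1); apply: ss; rewrite ltnS ?leq_maxl ?leq_maxr.
Qed.

End Realize.

(** * The theory of a generic space *)

Definition theory_of L (U : structure L) : theory L := [set p | holds U p].

Lemma theory_of_complete L (U : structure L) :
  inhabited U -> complete_theory (theory_of U).
Proof.
move=> iU; split; first by exists U.
move=> p; have [Up|Up] := EM (holds U p); [left|right] => U' [_]; exact.
Qed.

(** Genericity is first-order: for each finite distance matrix and each Katetov [f], one sentence
    says that every tuple with that matrix has a point realizing [f]. *)
Lemma theory_of_generic n (G U : structure (metric_language n))
    (d : G -> G -> nat) :
  measures n d -> generic n d -> inhabited G -> model (theory_of G) U ->
  exists d' : U -> U -> nat, measures n d' /\ generic n d'.
Proof.
move=> md [Md ext] iG [iU GU].
have [d' [md' Md']] : exists d' : U -> U -> nat, measures n d' /\ metric n d'.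
  apply: model_metric; split=> // p Tp; apply: GU.
  by have [_] := metric_model md Md iG; exact.
exists d'; split=> //; split=> // m s f [fn fd].
pose h (i : opts m) : 'I_m := cast_ord (card_opts m) (enum_rank i).
pose h' (i : 'I_m) : opts m := enum_val (cast_ord (esym (card_opts m)) i).
have hK i : h (h' i) = i by rewrite /h /h' enum_valK cast_ordKV.
have h'K i : h' (h i) = i by rewrite /h /h' cast_ordK enum_rankK.
pose r (vw : opts m * opts m) : nat := d' (s (h vw.1)) (s (h vw.2)).
have rn vw : r vw < n.+1 := dist_le Md' _ _.
pose diagram := Conj (fun vw : opts m * opts m =>
  @Dist n _ (inord (r vw)) vw.1 vw.2).
have /holds_all_closure/(_ (s \o h)) : holds U (all_closure (Imp diagram
    (extension n (f \o h)))).
  apply: GU; apply/holds_all_closure => s' Hs'.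
  have s'd v w : d (s' v) (s' w) = r (v, w).
    have := iffLR (sat_Conj _ _) Hs' (v, w).
    by move=> /(iffLR (sat_Dist _ _ _ _ md)); rewrite inordK.
  apply/(sat_extension _ md) => [v|]; first exact: fn.
  have [|u Hu] := ext m (s' \o h') f.
    by split=> // i j; rewrite /= s'd /r /= !hK.
  by exists u => v; rewrite -[v in s' v]h'K; exact: Hu.
move=> H; have /(sat_extension _ md') : sat (s \o h) (extension n (f \o h)).
  apply: H; apply/sat_Conj => -[v w]; apply/(sat_Dist _ _ _ _ md').
  by rewrite inordK.
move=> /(_ (fun v => fn (h v)))[u Hu].
by exists u => i; have := Hu (h' i); rewrite /= hK.
Qed.

(** * The strong order property *)

(* Shortest-path distance, cut off at [n], between [(s, i)] and [(t, j)] in the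
   graph on [Z x nat] with an edge between [(s, i)] and [(t, i + 1)] when
   [s < t] *)
Definition chain_dist n s i t j :=
  minn n (if i < j then j - i + (if s + (j - i) <= t then 0 else 2)
          else if j < i then i - j + (if t + (i - j) <= s then 0 else 2)
          else if s == t then 0 else 2).

Lemma chain_distT n s i t j u k :
  chain_dist n s i u k <= chain_dist n s i t j + chain_dist n t j u k.
Proof.
rewrite /chain_dist.
case: (ltngtP i j) => ij; case: (ltngtP j k) => jk; case: (ltngtP i k) => ik;
  repeat case: ifP => ?; lia.
Qed.

Lemma generic_extends n T (d : T -> T -> nat) (J : finType) (t : J -> T) :
  generic n d -> extends_over n d t.
Proof.
move=> gd m s f [fn fd].
pose V := (J + 'I_m)%type.
have [|u Hu] := @generic_seq n T d V (enum [the finType of V]) (join t s) f gd.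
  by move=> v w _ _; have [? ?] := fd v w; split; rewrite ?fn.
exists u => j; apply: Hu; have := mem_enum [the finType of V] j.
by rewrite inE; elim: (enum _) => //= v l' IH;
  rewrite in_cons => /orP[/eqP->|/IH]; [left | right].
Qed.

(* The witness [p(x, y)] says [d(x_i, y_(i+1)) = 1] for all [i] and
   [d(y_0, x_q) = n].  Around an [n]-cycle the unit steps join these last two
   points by a path of length [q < n]. *)
Lemma generic_SOP q (G : structure (metric_language q.+1))
    (d : G -> G -> nat) : 0 < q ->
  measures q.+1 d -> generic q.+1 d -> inhabited G ->
  SOP q.+1 (theory_of G).
Proof.
move=> q0 md gd iG; exists q.+1.
exists (Conj (fun o : option 'I_q => match o with
  | Some i => Dist (inord 1) (inl (widen_ord (leqnSn q) i)) (inr (lift ord0 i))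
  | None => Dist ord_max (inr ord0) (inl ord_max)
  end)); split.
  exists G; split=> //.
  (* The base is empty, so [e] carries no condition. *)
  pose t (v : void) : G := of_void G v.
  pose e (z : nat * 'I_q.+1) (v : void) := 0.
  pose D (z z' : nat * 'I_q.+1) := chain_dist q.+1 z.1 z.2 z'.1 z'.2.
  have eD : amalgam q.+1 d t e D.
    split=> [z|z z' []|z z' []|z|z z'|x y z|z z'].
    - by split=> -[].
    - by rewrite /D /chain_dist ltnn eqxx minn0.
    - rewrite /D /chain_dist (eq_sym z.1).
      by case: (ltngtP z.2 z'.2).
    - exact: chain_distT.
    - exact: geq_minl.
  have [s [_ sD]] := realize (proj1 gd) (generic_extends gd) eD.
  exists (fun k i => s (k, i)) => k k' kk'; apply/sat_Conj => -[i|].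
    apply/(sat_Dist _ _ _ _ md); rewrite inordK // sD /D /chain_dist /=.
    by rewrite /bump /= add1n ltnSn subSnn addn1 kk'; lia.
  (* As [k < k'], no ascending path leads from [(k', 0)] to [(k, q)]; the detour of length [q + 2]
     is cut off at [q.+1]. *)
  apply/(sat_Dist _ _ _ _ md); rewrite sD /D /chain_dist /= q0 subn0.
  by rewrite ifN; lia.
move=> U TU [c Hc]; have [d' [md' [Md' _]]] := theory_of_generic md gd iG TU.
have step (i : 'I_q.+1) (o : option 'I_q) := iffLR (sat_Conj _ _) (Hc i) o.
have path i : i <= q -> d' (c ord0 ord0) (c (inord i) (inord i)) <= i.
  elim: i => [|i IH] iq.
    by rewrite (_ : inord 0 = ord0) ?(distxx Md') //; apply: val_inj; rewrite /= inordK.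
  have := iffLR (sat_Dist _ _ _ _ md') (step (inord i) (Some (Ordinal iq))).
  rewrite inordK //= => d1; have := IH (ltnW iq).
  have := distT Md' (c ord0 ord0) (c (inord i) (inord i))
    (c (inord i.+1) (inord i.+1)).
  have E1 : ordS (inord i) = inord i.+1 :> 'I_q.+1.
    by apply: val_inj; rewrite /= !inordK ?modn_small // ltnS ltnW.
  have E2 : lift ord0 (Ordinal iq) = inord i.+1 :> 'I_q.+1.
    by apply: val_inj; rewrite /= inordK.
  have E3 : widen_ord (leqnSn q) (Ordinal iq) = inord i.
    by apply: val_inj; rewrite /= inordK // ltnS ltnW.
  by move: d1; rewrite E1 E2 E3; lia.
have := path q (leqnn q).
have -> : inord q = ord_max :> 'I_q.+1 by apply: val_inj; rewrite /= inordK.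
have := iffLR (sat_Dist _ _ _ _ md') (step ord_max None); rewrite /=.
have -> : ordS ord_max = ord0 :> 'I_q.+1 by apply: val_inj; rewrite /= modnn.
by move=> ->; rewrite ltnn.
Qed.

(** * Cardinality and saturation *)

Lemma infinite_or_countable (J : Type) :
  (exists g : nat -> J, injective g) \/ (exists h : J -> nat, injective h).
Proof.
have [Jfin|/infiniteP/card_leP[f]] := EM (finite_set [set: J]); [right|left].
  have /countable_injP[h hinj] := finite_set_countable Jfin.
  by exists h => x y; apply: hinj; rewrite inE.
exists (fun i => set_val (f (to_setT i))) => i j /val_inj fij.
have /(_ _ _ _ _ fij) : {in [set: [set: nat]] &, injective f} by exact: inj.
by rewrite !inE => /(_ I I)/(congr1 val).
Qed.

(** If [nat] injects into [J] by [g], the image of [g] is moved to its even places and [Z] put on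
    the odd ones. Otherwise [J + Z] is countable. *)
Lemma small_sum K J (Z : countType) :
  small K nat -> small K J -> small K (J + Z).
Proof.
move=> Kn KJ [f finj]; case: (infinite_or_countable J) => -[g ginj].
  apply: KJ; pose h (x : J + Z) : J := match x with
    | inl j => if pselect (exists i, g i = j) is left e
               then g (projT1 (cid e)).*2 else j
    | inr z => g (pickle z).*2.+1
    end.
  suff hinj : injective h by exists (h \o f); exact: inj_comp.
  move=> [j|z] [j'|z'] /=.
  - case: pselect => [e|N]; case: pselect => [e'|N'].
    + case: cid => i /= ei; case: cid => i' /= ei' /ginj /(can_inj doubleK) ii'.
      by rewrite -ei -ei' ii'.
    + by case: cid => i _ /= gj; case: N'; exists i.*2.
    + by case: cid => i _ /= gj; case: N; exists i.*2.
    + by move->.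
  - case: pselect => [e|N]; last by move=> gj; case: N; exists (pickle z').*2.+1.
    by case: cid => i _ /= /ginj /(congr1 odd) /=; rewrite !odd_double.
  - case: pselect => [e|N]; last by move=> gj; case: N; exists (pickle z).*2.+1.
    by case: cid => i _ /= /ginj /(congr1 odd) /=; rewrite !odd_double.
  - by move=> /ginj[] /(can_inj doubleK) /(pcan_inj pickleK) ->.
apply: Kn; pose h (x : J + Z) := match x with
  | inl j => (g j).*2 | inr z => (pickle z).*2.+1 end.
suff hinj : injective h by exists (h \o f); exact: inj_comp.
move=> [j|z] [j'|z'] /=.
- by move=> /(can_inj doubleK) /ginj ->.
- by move=> /(congr1 odd) /=; rewrite !odd_double.
- by move=> /(congr1 odd) /=; rewrite !odd_double.
- by move=> [] /(can_inj doubleK) /(pcan_inj pickleK) ->.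
Qed.

Lemma small_range K J U (t : J -> U) : small K J -> small K {u | range t u}.
Proof.
move=> KJ [f finj]; apply: KJ.
have pre k : exists j, t j = sval (f k).
  by case: (f k) => u /= [j _ <-]; exists j.
exists (fun k => projT1 (cid (pre k))) => k k' e; apply: finj.
apply: eq_sig_hprop => [*|].
  exact: Prop_irrelevance.
by rewrite -(projT2 (cid (pre k))) e (projT2 (cid (pre k'))).
Qed.

Section Saturation.
Variables (K : Type) (n : nat) (U : structure (metric_language n)).
Variable d : U -> U -> nat.
Hypotheses (Kn : small K nat) (Us : saturated K U).
Hypotheses (md : measures n d) (gd : generic n d).

(** The conditions [d(x, t j) = f j] are finitely satisfiable by genericity. *)
Lemma saturated_point J (t : J -> U) (f : J -> nat) :
  small K J -> katetov n d t f -> exists u, forall j, d u (t j) = f j.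
Proof.
move=> KJ [fn fd].
pose param j : {u | range t u} := exist _ (t j) (ex_intro2 _ _ j I erefl).
pose phi j : formula (metric_language n) ('I_1 + {u | range t u}) :=
  Dist (inord (f j)) (inl ord0) (inr (param j)).
have [l q qP|c Hc] := Us (small_range KJ) (p := range phi).
  have [j Hj] := choice (fun i => let: ex_intro2 j _ e := qP i in
    ex_intro (fun j => phi j = q i) j e).
  have [|u Hu] := proj2 gd l (t \o j) (f \o j).
    by split=> [i|i i'] /=; [exact: fn | exact: fd].
  exists (fun=> u) => i; rewrite -Hj; apply/(sat_Dist _ _ _ _ md).
  by rewrite /= (Hu i) inordK // ltnS.
exists (c ord0) => j; have := Hc (phi j) (ex_intro2 _ _ j I erefl).
by move=> /(iffLR (sat_Dist _ _ _ _ md)); rewrite inordK // ltnS.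
Qed.

Lemma saturated_extends J (t : J -> U) : small K J -> extends_over n d t.
Proof.
by move=> KJ m s f; apply: saturated_point; exact: small_sum.
Qed.

End Saturation.

(** * Amalgams truncated at a given distance *)

Section Truncated.
Variables (n : nat) (T : Type) (d : T -> T -> nat) (M : set T).
Hypothesis Md : metric n d.

(* [r] exceeds [b] only if the distances to [M] impose [r <= d(x, y)]. *)
Definition capped (b r : nat) (x y : T) :=
  r <= b \/ exists m, M m /\ (r + d y m <= d x m \/ r + d x m <= d y m).

(* [r] is below [min a n] only if the distances to [M] impose [d(x, y) <= r]. *)
Definition floored (a r : nat) (x y : T) :=
  [\/ a <= r, n <= r | exists m, M m /\ d x m + d y m <= r].

Definition moderate (a b r : nat) (x y : T) := floored a r x y /\ capped b r x y.

(** The point lying in [M] itself witnesses both bounds. *)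
Lemma moderate_base a b x y : M x \/ M y -> moderate a b (d x y) x y.
Proof.
move=> [Mx|My]; split.
- by apply: Or33; exists x; rewrite (distxx Md) (distC Md y).
- by right; exists x; split=> //; rewrite (distxx Md) (distC Md y); lia.
- by apply: Or33; exists y; rewrite (distxx Md) addn0.
- by right; exists y; split=> //; rewrite (distxx Md) addn0; left.
Qed.

Lemma moderate_eq a b r x y x' y' :
  (forall m, M m -> d x' m = d x m) -> (forall m, M m -> d y' m = d y m) ->
  moderate a b r x y -> moderate a b r x' y'.
Proof.
move=> ex ey [lo up]; split.
  case: lo => [?|?|[m [Mm lo]]]; [exact: Or31|exact: Or32|apply: Or33].
  by exists m; rewrite ex // ey.
by case: up => [?|[m [Mm up]]]; [left|right; exists m; rewrite ex // ey].
Qed.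

(* If [a] is moderate over [x] and [y], then the lower bound [d(x, a) - d(y, a)]
   on [d(x, y)] is at most [b - a] unless [M] already imposes it. *)
Lemma capped_diff a b b' z x y r :
  moderate a b (d z x) z x -> moderate a b (d z y) z y -> b <= b' + a ->
  r + d y z <= d x z -> capped b' r x y.
Proof.
move=> [_ up] [lo _] bb'; rewrite (distC Md y) (distC Md x) => rz.
case: lo => [lo|lo|[m [Mm lo]]].
- case: up => [up|[m [Mm up]]]; first by left; lia.
  right; exists m; split=> //.
  have := distT Md z y m; have := distT Md y z m; rewrite (distC Md y z).
  by case: up; lia.
- by left; have := dist_le Md z x; lia.
- right; exists m; split=> //; left.
  by have := distT Md z m x; rewrite (distC Md m x); lia.
Qed.

(** Inside the interval one difference is at most [d x c <= b], the other at most
    [n - d x c <= n - a <= b]. Bounds imposed by [M] on [x] and [c] pass to [x] and [w] by the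
    triangle inequality. *)
Lemma capped_diff_side a b c x w r :
  moderate a b (d x c) x c -> n <= a + b ->
  r + d w c <= d x c \/ r + d x c <= d w c -> capped b r x w.
Proof.
move=> [lo up] nab; have rt u v s := distT Md u v s.
have := dist_le Md w c => wn.
case=> rc.
  case: up => [up|[m [Mm up]]]; first by left; lia.
  right; exists m; split=> //; have := rt w c m; have := rt c w m.
  by rewrite (distC Md c w); case: up; lia.
case: lo => [lo|lo|[m [Mm lo]]]; [by left; lia|by left; lia|].
right; exists m; split=> //; right.
by have := rt w m c; rewrite (distC Md m c); lia.
Qed.

Variables (C : set T) (b : nat).

(** The bounds range over possibly infinite [C] and [M]; taking the largest admissible [h] avoids
    infima over them. *)
Definition admissible (h : nat) (x y : T) :=
  [/\ h <= n, forall c, C c -> h <= d x c + d y c & capped b h x y].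

(* The free amalgam over [C], truncated at [b] *)
Definition truncated (x y : T) : nat :=
  \max_(h < n.+1 | `[< admissible h x y >]) h.

Lemma truncated_max h x y : admissible h x y -> h <= truncated x y.
Proof.
move=> ah; have [hn _ _] := ah.
apply: (@leq_bigmax_cond _ (fun h : 'I_n.+1 => `[< admissible h x y >])
  (fun h => h : nat) (Ordinal (hn : h < n.+1))).
exact/asboolP.
Qed.

Lemma truncated_admissible x y : admissible (truncated x y) x y.
Proof.
have a0 : admissible (@ord0 n) x y by split=> //; left.
rewrite /truncated (bigmax_eq_arg ord0); last exact/asboolP.
by case: arg_maxnP => [|i /asboolP]; first exact/asboolP.
Qed.

Lemma truncated_le x y : truncated x y <= n.
Proof. by have [] := truncated_admissible x y. Qed.

Lemma truncatedC x y : truncated x y = truncated y x.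
Proof.
suff le u v : truncated u v <= truncated v u by apply/eqP; rewrite eqn_leq !le.
have [hn hC cap] := truncated_admissible u v.
apply: truncated_max; split=> // [c Cc|]; first by rewrite addnC; exact: hC.
by case: cap => [?|[m [Mm ?]]]; [left|right; exists m; split=> //; lia].
Qed.

(** An admissible value for [x] and [y], lowered by [d y z], is admissible for [x] and [z]. *)
Lemma truncated_lip x y z : truncated x y <= truncated x z + d y z.
Proof.
have [hn hC cap] := truncated_admissible x y.
suff : truncated x y - d y z <= truncated x z by lia.
apply: truncated_max; split=> [|c Cc|]; first by lia.
  by have := hC c Cc; have := distT Md y z c; lia.
case: cap => [?|[m [Mm cap]]]; [by left; lia|right; exists m; split=> //].
have := distT Md y z m; have := distT Md z y m; rewrite (distC Md z y).
by case: cap; lia.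
Qed.

(** If all three failed, the successor of [truncated x y] would still be admissible. *)
Lemma truncated_cases x y : [\/ n <= truncated x y, b <= truncated x y |
  exists c, C c /\ d x c + d y c <= truncated x y].
Proof.
have [hn hC cap] := truncated_admissible x y.
have [?|lt_n] := leqP n (truncated x y); first exact: Or31.
have [?|lt_b] := leqP b (truncated x y); first exact: Or32.
have [?|N] := EM (exists c, C c /\ d x c + d y c <= truncated x y).
  exact: Or33.
have : (truncated x y).+1 <= truncated x y; last by rewrite ltnn.
apply: truncated_max; split=> // [c Cc|]; last by left.
by rewrite ltnNge; apply/negP => le; apply: N; exists c.
Qed.

(* [truncated x y] respects the lower bounds on [d(x, y)] coming from [C]. *)
Definition over_base x y := forall c, C c ->
  d x c <= d y c + truncated x y /\ d y c <= d x c + truncated x y.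

Lemma over_baseC x y : over_base x y -> over_base y x.
Proof. by move=> xy c /xy[]; rewrite truncatedC. Qed.

(** A lower bound [r] coming from [C] satisfies the other two conditions of admissibility by the
    triangle inequality, so [truncated] dominates it. *)
Lemma over_base_capped x y :
  (forall c r, C c -> r + d y c <= d x c \/ r + d x c <= d y c ->
     capped b r x y) -> over_base x y.
Proof.
move=> cap c Cc.
have adm r : r + d y c <= d x c \/ r + d x c <= d y c -> r <= truncated x y.
  move=> rc; apply: truncated_max; split.
  - by have := dist_le Md x c; have := dist_le Md y c; case: rc; lia.
  - move=> c' _; have := distT Md x c' y; rewrite (distC Md c' y).
    have := distT Md x y c; have := distT Md y x c; rewrite (distC Md y x).
    by case: rc; lia.
  - exact: (cap c).
by have := adm (d x c - d y c); have := adm (d y c - d x c); lia.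
Qed.

Lemma over_base_side a x w : n <= a + b ->
  (forall c, C c -> moderate a b (d x c) x c) -> over_base x w.
Proof.
move=> nab mod; apply: over_base_capped => c r Cc.
exact: (capped_diff_side (mod c Cc)).
Qed.

Lemma truncated_base x c : C c -> over_base x c -> truncated x c = d x c.
Proof.
move=> Cc /(_ c Cc)[+ _]; have [_ /(_ c Cc)+ _] := truncated_admissible x c.
by rewrite (distxx Md); lia.
Qed.

(** Two values of at least [b] add up to at least [n]. If one value is reached through some [c] in
    [C], [over_base] of the other at [c] reduces both claims to paths through [c]. *)
Lemma truncated_sum x y z : n <= b.*2 -> over_base x y -> over_base y z ->
  d x z <= truncated x y + truncated y z /\
  truncated x z <= truncated x y + truncated y z.
Proof.
move=> nb xy yz; have [xzn xzC _] := truncated_admissible x z.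
have dn := dist_le Md x z.
case: (truncated_cases x y) => [?|bxy|[c [Cc le]]]; first by lia.
  case: (truncated_cases y z) => [?|byz|[c [Cc le]]]; [by lia|by lia|].
  have [+ +] := xy c Cc; have := xzC c Cc; have := distT Md x c z.
  by rewrite (distC Md c z); lia.
have [+ +] := yz c Cc; have := xzC c Cc; have := distT Md x c z.
by rewrite (distC Md c z); lia.
Qed.

Lemma truncated_moderate a x y : a <= b ->
  (forall c, C c -> floored a (d x c + d y c) x y) ->
  moderate a b (truncated x y) x y.
Proof.
move=> ab flo; have [_ _ cap] := truncated_admissible x y; split=> //.
case: (truncated_cases x y) => [?|?|[c [/flo + le]]].
- exact: Or32.
- by apply: Or31; lia.
- case=> [?|?|[m [Mm ?]]]; [apply: Or31; lia|apply: Or32; lia|apply: Or33].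
  by exists m; split=> //; lia.
Qed.

End Truncated.

(** * Independence in a generic space *)

(** [X] may be infinite; only the finitely many variables occurring in [p] are moved. *)
Definition xvars L X m (p : formula L (X + 'I_m)) : seq X :=
  pmap (fun v => if v is inl x then Some x else None) (fv p).

Lemma In_xvars L X m (p : formula L (X + 'I_m)) x :
  List.In (inl x) (fv p) -> List.In x (xvars p).
Proof.
rewrite /xvars; elim: (fv p) => //= -[y|v] l IH [e|/IH] //=; last by right.
by case: e => ->; left.
Qed.

Lemma In_flatten V (I : finType) (F : I -> seq V) i v :
  List.In v (F i) -> List.In v (flatten [seq F i | i <- enum I]).
Proof.
move=> vi; have : i \in enum I by rewrite mem_enum.
elim: (enum I) => //= j l IH; rewrite in_cons => /orP[/eqP <-|/IH ?].
  by apply/In_cat; left.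
by apply/In_cat; right.
Qed.

(** Passes from a realization indexed by positions in [l] to an assignment on [X], choosing one
    position for each repeated variable. *)
Lemma choose_on_list X U (l : seq X) (a : X -> U) (s : 'I_(size l) -> U) :
  exists a' : X -> U, forall x, List.In x l ->
    exists k, tnth (in_tuple l) k = x /\ a' x = s k.
Proof.
exists (fun x => if pselect (exists k, tnth (in_tuple l) k = x) is left E
                 then s (projT1 (cid E)) else a x).
move=> x xl; have E := seqIn_tnth xl; case: pselect => // E'.
by exists (projT1 (cid E')); split=> //; exact: projT2 (cid E').
Qed.

Section Core.
Variables (K : Type) (n : nat) (U : structure (metric_language n)).
Variables (d : U -> U -> nat) (M : set U).
Hypotheses (Kn : small K nat) (Us : saturated K U).
Hypotheses (md : measures n d) (gd : generic n d).
Hypothesis KM : small K {x | M x}.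

Let Md : metric n d := proj1 gd.

Lemma sat_join_isometry X m (p : formula (metric_language n) (X + 'I_m))
    (a a' : X -> U) (b b' : 'I_m -> U) :
  (forall x y, List.In x (xvars p) -> List.In y (xvars p) ->
     d (a' x) (a' y) = d (a x) (a y)) ->
  (forall x v, List.In x (xvars p) -> d (a' x) (b' v) = d (a x) (b v)) ->
  (forall v w, d (b' v) (b' w) = d (b v) (b w)) ->
  sat (join a b) p -> sat (join a' b') p.
Proof.
move=> aa ab bb; apply: (iffLR (sat_isometry md md gd gd _)).
move=> [x|v] [y|w] xp yp /=; apply/esym.
- by apply: aa; exact: In_xvars.
- by apply: ab; exact: In_xvars.
- by rewrite (distC Md) (distC Md (b v)); apply: ab; exact: In_xvars.
- exact: bb.
Qed.

Lemma realize_list X (l : seq X) (a : X -> U) J (t : J -> U) (e : X -> J -> nat) :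
  small K J ->
  (forall x, List.In x l -> katetov n d t (e x)) ->
  (forall x y j, List.In x l -> List.In y l ->
     e x j <= d (a x) (a y) + e y j /\ d (a x) (a y) <= e x j + e y j) ->
  exists a' : X -> U,
    (forall x j, List.In x l -> d (a' x) (t j) = e x j) /\
    (forall x y, List.In x l -> List.In y l -> d (a' x) (a' y) = d (a x) (a y)).
Proof.
move=> KJ eK ea; pose z := tnth (in_tuple l).
have eD : amalgam n d t (fun k => e (z k)) (fun k k' => d (a (z k)) (a (z k'))).
  split=> [k|k k' j|k k' j|k|k k'|k k' k''|k k'].
  - by apply: eK; exact: In_tnth.
  - by have [] := ea (z k) (z k') j (In_tnth (in_tuple l) k)
      (In_tnth (in_tuple l) k').
  - by have [] := ea (z k) (z k') j (In_tnth (in_tuple l) k)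
      (In_tnth (in_tuple l) k').
  - exact: distxx Md _.
  - exact: distC Md _ _.
  - exact: distT Md _ _ _.
  - exact: dist_le Md _ _.
have [s [st ss]] := realize Md (saturated_extends Kn Us md gd KJ) eD.
have [a' a'P] := choose_on_list a s.
exists a'; split=> [x j /a'P[k [<- ->]]|x y /a'P[k [<- ->]] /a'P[k' [<- ->]]] //.
Qed.

Lemma indiscernible_dist m (c : nat -> 'I_m -> U) :
  (forall i j i' j' v w, (i == j) = (i' == j') ->
     d (c i v) (c j w) = d (c i' v) (c j' w)) ->
  (forall i j v x, M x -> d (c i v) x = d (c j v) x) ->
  indiscernible M c.
Proof.
move=> cc cM r s t hs ht p.
have inj (u : 'I_r -> nat) : {homo u : i j / i < j} -> forall i j,
    (u i == u j) = (i == j).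
  move=> hu i j; apply/eqP/eqP => [uij|-> //]; apply: ord_inj.
  by case: (ltngtP i j) => // /hu; rewrite uij ltnn.
apply: (sat_isometry md md gd gd) => -[[i v]|x] [[j w]|y] _ _ //=.
- by apply: cc; rewrite !inj.
- exact: cM (svalP y).
- by rewrite (distC Md) (distC Md (sval x)); exact: cM (svalP x).
Qed.

Lemma indiscernible_lt m (c : nat -> 'I_m -> U) : indiscernible M c ->
  forall i j i' j' v w, i < j -> i' < j' ->
    d (c i v) (c j w) = d (c i' v) (c j' w).
Proof.
move=> ic i j i' j' v w ij ij'; have lt := dist_le Md (c i v) (c j w).
pose pr (i j : nat) (k : 'I_2) := if k == ord0 then i else j.
have hpr k l : k < l -> {homo pr k l : i j / i < j}.
  by move=> kl [[|[]]] // ? [[|[]]].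
have := ic 2 (pr i j) (pr i' j') (hpr _ _ ij) (hpr _ _ ij')
  (Dist (inord (d (c i v) (c j w))) (inl (ord0, v)) (inl (ord_max, w))).
rewrite !(sat_Dist _ _ _ _ md) /= inordK // => E.
by apply/esym; apply: (iffLR E).
Qed.

Lemma indiscernible_diag m (c : nat -> 'I_m -> U) : indiscernible M c ->
  forall i j v w, d (c i v) (c i w) = d (c j v) (c j w).
Proof.
move=> ic i j v w; have lt := dist_le Md (c i v) (c i w).
have hom k : {homo (fun _ : 'I_1 => k) : i j / i < j}.
  by move=> [[]] // ? [[]].
have := ic 1 _ _ (hom i) (hom j)
  (Dist (inord (d (c i v) (c i w))) (inl (ord0, v)) (inl (ord0, w))).
rewrite !(sat_Dist _ _ _ _ md) /= inordK // => E.
by apply/esym; apply: (iffLR E).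
Qed.

Lemma indiscernible_base m (c : nat -> 'I_m -> U) : indiscernible M c ->
  forall i j v x, M x -> d (c i v) x = d (c j v) x.
Proof.
move=> ic i j v x Mx; have lt := dist_le Md (c i v) x.
have hom k : {homo (fun _ : 'I_1 => k) : i j / i < j}.
  by move=> [[]] // ? [[]].
have := ic 1 _ _ (hom i) (hom j)
  (Dist (inord (d (c i v) x)) (inl (ord0, v)) (inr (exist _ x Mx))).
rewrite !(sat_Dist _ _ _ _ md) /= inordK // => E.
by apply/esym; apply: (iffLR E).
Qed.

Let mod a b x y := moderate n d M a b (d x y) x y.

(** Moderation is asked only at the variables of [p], because realizations built by [realize_list]
    are controlled only on a list. *)
Definition nondividing_between (D : dividing_notion U) a b :=
  forall X m (p : formula (metric_language n) (X + 'I_m)) (x : X -> U)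
    (y : 'I_m -> U),
  (forall i v, List.In i (xvars p) -> mod a b (x i) (y v)) ->
  sat (join x y) p -> ~ D X m p y.

Lemma nondividing0 a b : n <= a.*2 -> b <= a.+1 ->
  nondividing_between (@divides _ U M) a b.
Proof.
move=> na ba X m p x y xy sp [c [ic c0 incons]]; apply: incons.
have cM i v z : M z -> d (c i v) z = d (y v) z.
  by move=> Mz; rewrite (indiscernible_base ic i 0) // c0.
have cd i v w : d (c i v) (c i w) = d (y v) (y w).
  by rewrite (indiscernible_diag ic i 0) c0.
(* [d(y_v, y_w) <= 3 d(c_i v, c_j w)], through [c_1 v, c_2 w, c_0 v, c_1 w] *)
have c3 i j v w : i < j -> d (y v) (y w) <= 3 * d (c i v) (c j w).
  move=> ij; rewrite -(cd 1).
  have := distT Md (c 1 v) (c 2 w) (c 1 w).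
  have := distT Md (c 2 w) (c 0 v) (c 1 w).
  rewrite (distC Md (c 2 w) (c 0 v)).
  rewrite (@indiscernible_lt _ _ ic 1 2 i j) //.
  rewrite (@indiscernible_lt _ _ ic 0 2 i j) //.
  by rewrite (@indiscernible_lt _ _ ic 0 1 i j) //; lia.
(* Two distances in the interval differ by at most one, which a positive [E] absorbs; if [E = 0],
   the factor three makes [y v] and [y w] coincide. *)
have key u v w E : mod a b u (y v) -> mod a b u (y w) ->
    d (y v) (y w) <= 3 * E ->
    (forall z, M z -> d (y v) z <= d (y w) z + E /\ d (y w) z <= d (y v) z + E) ->
    d u (y v) <= d u (y w) + E.
  move=> [_ up] [lo _] E3 EM; have rt p q s := distT Md p q s.
  case: lo => [lo|lo|[z [Mz lo]]].
  - case: up => [up|[z [Mz up]]].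
      case: (posnP E) => [E0|]; last by lia.
      rewrite E0 addn0; have yvw : d (y v) (y w) = 0 by lia.
      by have := rt u (y w) (y v); rewrite (distC Md (y w) (y v)); lia.
    have [? ?] := EM z Mz; have := rt u (y w) z; have := rt (y w) u z.
    by rewrite (distC Md (y w) u); case: up; lia.
  - by have := dist_le Md u (y v); lia.
  - have [? ?] := EM z Mz; have := rt u z (y v); rewrite (distC Md z); lia.
(* Two distances of at least [a] sum to [2 * a >= n >= E]; a distance realized through [M] is
   handled by the bound [EM]. *)
have key2 u v w E : mod a b u (y v) -> mod a b u (y w) -> E <= n ->
    (forall z, M z -> E <= d (y v) z + d (y w) z) ->
    E <= d u (y v) + d u (y w).
  move=> [lo _] [lo' _] En EM; have rt p q s := distT Md p q s.
  have alt v' w' : (exists z, M z /\ d u z + d (y v') z <= d u (y v')) ->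
      (forall z, M z -> E <= d (y v') z + d (y w') z) ->
      E <= d u (y v') + d u (y w').
    move=> [z [Mz le]] /(_ z Mz); have := rt (y w') u z.
    by rewrite (distC Md (y w') u); lia.
  case: lo => [lo|lo|/alt]; [|by lia|by apply].
  case: lo' => [lo'|lo'|/alt /(_ _) H]; [by lia|by lia|].
  by rewrite addnC; apply: H => z Mz; rewrite addnC; exact: EM.
(* The distances from [x] to [y] are copied to every term of [c]; [key] and [key2] give the Katetov
   conditions. *)
have [|||x' [x'c x'x']] := @realize_list X (xvars p) x (nat * 'I_m)%type
  (fun iv => c iv.1 iv.2) (fun u iv => d (x u) (y iv.2)).
- move=> [f finj]; apply: Kn; exists (pickle \o f).
  exact: inj_comp (pcan_inj pickleK) finj.
- move=> u ul; split=> [[i v]|[i v] [j w]] /=; first exact: dist_le Md _ _.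
  have mv := xy u v ul; have mw := xy u w ul.
  have [->|ij] := eqVneq i j.
    rewrite cd; have := distT Md (x u) (y w) (y v).
    have := distT Md (y v) (x u) (y w).
    by rewrite (distC Md (y v) (x u)) (distC Md (y w) (y v)); lia.
  have sum : d (c i v) (c j w) <= d (x u) (y v) + d (x u) (y w).
    apply: key2 => // [|z Mz]; first exact: dist_le Md _ _.
    rewrite -(cM i v) // -(cM j w) // (distC Md (c j w)).
    exact: distT Md _ _ _.
  split=> //; apply: key => // [|z Mz].
    case: (ltngtP i j) ij => // ij _; first exact: c3.
    by rewrite (distC Md (y v)) (distC Md (c i v)); exact: c3.
  rewrite -!(cM i v) // -!(cM j w) //.
  have := distT Md (c i v) (c j w) z; have := distT Md (c j w) (c i v) z.
  by rewrite (distC Md (c j w) (c i v)); lia.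
- move=> u u' [i v] _ _ /=; have := distT Md (x u) (x u') (y v).
  have := distT Md (x u) (y v) (x u'); rewrite (distC Md (y v)); lia.
exists x' => i; apply: sat_join_isometry sp => // u v ul.
exact: x'c _ (i, v) ul.
Qed.

(* Forking adds only the choice of [x'] realizing the type of [x] over the
   parameters of [p] and moderate over the parameters of the disjuncts; the
   truncated amalgam provides it. *)
Lemma independent_between (D : dividing_notion U) a b :
  n <= a + b -> a <= b -> nondividing_between D a b ->
  forall X Y (x : X -> U) (y : Y -> U),
  (forall i j, mod a b (x i) (y j)) -> independent M D x y.
Proof.
move=> nab ab ND X Y x y xy m p c cP sp [N [ar [q [e [De pq]]]]].
have nb : n <= b.*2 by lia.
pose l := xvars p ++ flatten [seq xvars (q i) | i <- enum 'I_N].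
pose C := M `|` range c.
have MC : M `<=` C by move=> z; left.
pose W := ('I_m + {i : 'I_N & 'I_(ar i)})%type.
(* All points to which the new realization needs prescribed distances: [M], the parameters of [p],
   and those of the disjuncts. *)
pose t : {z | M z} + W -> U := join sval (fun w => match w with
  | inl v => c v | inr iv => e (tag iv) (tagged iv) end).
pose H := truncated n d M C b.
have xC i z : C z -> mod a b (x i) z.
  move=> Cz; have [Mz|NMz] := EM (M z); first by apply: moderate_base => //; right.
  case: Cz => [//|[v _ zE]]; case: (cP v) => [|[j _ yj]]; first by rewrite zE.
  by rewrite -zE -yj; exact: xy.
have lb i w : over_base n d M C b (x i) w.
  by apply: (over_base_side Md w nab) => z; exact: xC.
have lbC i w : over_base n d M C b w (x i) by apply: over_baseC; exact: lb.
have sum i w w' := truncated_sum Md nb (lbC i w) (lb i w').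
have sum' i j w := truncated_sum Md nb (lb i w) (lbC j w).
have lip w z z' : H w z <= H w z' + d z z' := truncated_lip M Md C b w z z'.
have HC w z : H w z = H z w := truncatedC n d M C b w z.
(* Over [C] the truncated distances are those of [x], so [x'] satisfies [p]. To the parameters of
   each disjunct they are moderate, so no disjunct satisfied by [x'] can divide. *)
have [|||x' [x't x'x']] := @realize_list X l x _ t (fun i j => H (x i) (t j)).
- exact: small_sum Kn KM.
- move=> i _; split=> [j|j j']; first exact: truncated_le.
  have [+ _] := sum i (t j) (t j'); rewrite -/H (HC (t j)).
  by have := lip (x i) (t j) (t j'); lia.
- move=> i i' j _ _; have [+ _] := sum' i i' (t j); rewrite -/H (HC (t j)).
  by have := lip (t j) (x i) (x i'); rewrite !(HC (t j)); lia.
have x'M i z : List.In i l -> M z -> d (x' i) z = d (x i) z.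
  move=> il Mz; rewrite (x't i (inl (exist _ z Mz)) il) /=.
  by apply: truncated_base; [exact: Md | left | exact: lb].
have lq i j : List.In j (xvars (q i)) -> List.In j l.
  by move=> jq; apply/In_cat; right; exact: In_flatten jq.
have lp j : List.In j (xvars p) -> List.In j l by move=> jp; apply/In_cat; left.
have [|i sq] := pq x'.
  apply: sat_join_isometry sp => // [i j ip jp|i v ip].
    by apply: x'x'; exact: lp.
  rewrite (x't i (inr (inl v)) (lp _ ip)) /=.
  by apply: truncated_base; [exact: Md | right; exists v | exact: lb].
apply: (ND _ _ _ _ _ _ sq (De i)) => j v /lq jl.
have /= E := x't j (inr (inr (Tagged _ v))) jl; rewrite /mod E.
apply: (@moderate_eq _ _ _ _ _ _ _ (x j) (e i v)) => // [z Mz|].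
  exact: x'M.
apply: truncated_moderate => // z Cz.
have [lo _] := xC j z Cz.
case: lo => [lo|lo|[u [Mu lo]]].
- by apply: Or31; lia.
- by apply: Or32; lia.
- apply: Or33; exists u; split=> //.
  by have := distT Md (e i v) z u; lia.
Qed.

(* The Morley sequence amalgamates copies of [y] freely over [M] and [x],
   truncated at [b']. *)
Lemma nondividing_step j a b a' b' :
  (forall X Y (x : X -> U) (y : Y -> U), (forall i v, mod a' b' (x i) (y v)) ->
     eth_independent M j x y) ->
  a' <= a.*2 -> b <= b' + a -> n <= b'.*2 -> a' <= b' ->
  nondividing_between (@eth_divides _ U M j.+1) a b.
Proof.
move=> IH aa bb nb ab X m p x y xy sp.
pose C := M `|` [set z | exists i, List.In i (xvars p) /\ x i = z].
have MC : M `<=` C by move=> z; left.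
pose B z := M z \/ range y z.
have CB z w : C z -> B w -> M z \/ M w \/ mod a b z w.
  move=> [Mz|[i [ip <-]]]; first by left.
  by move=> [Mw|[v _ <-]]; right; [left|right; exact: xy].
have modCB z w : C z -> B w -> mod a b z w.
  move=> Cz Bw; case: (CB z w Cz Bw) => [Mz|[Mw|//]];
    by apply: moderate_base; auto.
pose H := truncated n d M C b'.
have lb z w : B z -> B w -> over_base n d M C b' z w.
  move=> Bz Bw; apply: (over_base_capped Md) => c r Cc.
  have mz := modCB c z Cc Bz; have mw := modCB c w Cc Bw.
  case=> rc; first exact: (capped_diff Md mz mw bb rc).
  have [le|[u [Mu cap]]] := capped_diff Md mw mz bb rc; first by left.
  by right; exists u; split=> //; lia.
(* Label [Some i] marks the [i]-th copy of [B] and [None] marks [C]. Distances are the original ones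
   except between different copies, where they are truncated. *)
pose P (o o' : option nat) z w := match o, o' with
  | Some i, Some i' => if i == i' then d z w else H z w
  | _, _ => d z w end.
pose ok (o : option nat) z := if o is Some _ then B z else C z.
have HC z w : H z w = H w z := truncatedC n d M C b' z w.
have PC o o' z w : P o o' z w = P o' o w z.
  by case: o o' => [i|] [i'|] /=; rewrite ?(eq_sym i) 1?HC (distC Md).
have lip z w w' : H z w <= H z w' + d w w' := truncated_lip M Md C b' z w w'.
have ub z w c : C c -> H z w <= d z c + d w c.
  by have [_ + _] := truncated_admissible n d M C b' z w; exact.
have PT o o' o'' z w u : ok o z -> ok o' w -> ok o'' u ->
    P o o'' z u <= P o o' z w + P o' o'' w u.
  have := distT Md z w u => T1; have dC := distC Md.
  case: o o' o'' => [i|] [i'|] [i''|] //= Oz Ow Ou.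
  - have [sum1 sum2] := truncated_sum Md nb (lb z w Oz Ow) (lb w u Ow Ou).
    have [<-|ii'] := eqVneq i i'.
      by case: eqP => // _; rewrite (HC z) (HC w) addnC; exact: lip.
    have [<-|ii''] := eqVneq i' i''.
      by rewrite (negbTE ii') (dC w); exact: lip.
    by case: eqP => _.
  - case: eqP => // _; have [+ _] := lb z w Oz Ow u Ou; rewrite -/H; lia.
  - case: eqP => // _; rewrite (dC w); exact: ub.
  - case: eqP => // _; have [+ _] := lb u w Ou Ow z Oz.
    by rewrite -/H (HC u) (dC z) (dC z w); lia.
pose l := xvars p; pose z := tnth (in_tuple l).
pose lab (k : nat * 'I_m + 'I_(size l)) := if k is inl iv then Some iv.1 else None.
pose pt (k : nat * 'I_m + 'I_(size l)) :=
  match k with inl iv => y iv.2 | inr k => x (z k) end.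
(* The base is [M] with the copy labelled [Some 0], so that the sequence starts with [y] itself. *)
pose t : {u | M u} + 'I_m -> U := join sval y.
have okZ k : ok (lab k) (pt k).
  case: k => [[i v]|k] /=; first by right; exists v.
  by right; exists (z k); split=> //; exact: In_tnth.
have okJ k : ok (Some 0) (t k).
  by case: k => [[u Mu]|v] /=; [left|right; exists v].
have dP o u w : d u w = P o o u w by case: o => //= i; rewrite eqxx.
have Pn o o' u w : P o o' u w <= n.
  by case: o o' => [i|] [i'|] /=; rewrite ?dist_le //; case: eqP => _;
    [exact: dist_le Md _ _ | exact: truncated_le].
have eD : amalgam n d t (fun k k' => P (lab k) (Some 0) (pt k) (t k'))
    (fun k k' => P (lab k) (lab k') (pt k) (pt k')).
  split=> [k|k k' k''|k k' k''|k|k k'|k k' k''|k k'].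
  - split=> [k'|k' k'']; first exact: Pn.
    rewrite (dP (Some 0) (t k')); split; last first.
      by rewrite (PC (lab k) (Some 0) _ (t k')); exact: PT.
    by rewrite (PC (Some 0)); exact: PT.
  - exact: PT.
  - by rewrite (PC (lab k') (Some 0)); exact: PT.
  - by rewrite -dP (distxx Md).
  - exact: PC.
  - exact: PT.
  - exact: Pn.
have KJ : small K ({u | M u} + 'I_m) := small_sum Kn KM.
have [s [st ss]] := realize Md (saturated_extends Kn Us md gd KJ) eD.
pose c i v := s (inl (i, v)).
have cd i i' v w :
    d (c i v) (c i' w) = if i == i' then d (y v) (y w) else H (y v) (y w).
  exact: ss.
have By v : B (y v) by right; exists v.
have cM i v u : M u -> d (c i v) u = d (y v) u.
  move=> Mu; have /= -> := st (inl (i, v)) (inl (exist _ u Mu)).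
  case: eqP => // _; apply: truncated_base; [exact: Md|exact: MC|].
  by apply: lb => //; left.
have c0 : c 0 = y.
  apply: funext => v; apply: (dist0_eq Md).
  by have /= -> := st (inl (0, v)) (inr v); exact: distxx Md _.
(* A path between copies through [x i] has length at least [a.*2 >= a'], unless the distances to [M]
   impose less. *)
have Hmod v w : moderate n d M a' b' (H (y v) (y w)) (y v) (y w).
  apply: truncated_moderate => // u0 Cu.
  case: Cu => [Mu|[i [ip <-]]]; first by apply: Or33; exists u0.
  have rt := distT Md.
  have [[lo|lo|[u [Mu lo]]] _] := xy i v ip.
  - have [[lo'|lo'|[u [Mu lo']]] _] := xy i w ip.
    + by apply: Or31; rewrite !(distC Md _ (x i)); lia.
    + by apply: Or32; rewrite !(distC Md _ (x i)); lia.
    + apply: Or33; exists u; split=> //; have := rt (y v) (x i) u.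
      by rewrite !(distC Md _ (x i)); lia.
  - by apply: Or32; rewrite !(distC Md _ (x i)); lia.
  - apply: Or33; exists u; split=> //; have := rt (y w) (x i) u.
    by rewrite !(distC Md _ (x i)); lia.
move=> /(_ c); apply.
- split=> [|i].
    apply: indiscernible_dist => [i1 i2 i1' i2' v w e|i i' v u Mu].
      by rewrite !cd e.
    by rewrite !cM.
  apply: IH => v [i' w] /=; rewrite /mod cd gtn_eqF //.
  by apply: moderate_eq (Hmod v w) => u Mu; rewrite cM.
- exact: c0.
(* The copy of [x] in the amalgam keeps its distances to every copy of [y], hence satisfies [p]
   along the whole Morley sequence. *)
have [x' x'P] := choose_on_list (l := l) x (s \o inr).
exists x' => i; apply: sat_join_isometry sp => [u w|u v|v w].
- by move=> /x'P[k [<- ->]] /x'P[k' [<- ->]]; exact: ss.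
- by move=> /x'P[k [<- ->]]; exact: ss.
- by rewrite cd eqxx.
Qed.

End Core.

(** Induction with [a] general: the hypothesis for [j] is used at [a.*2], which keeps the product
    [2 ^ j.+1 * a] fixed and narrows the interval by [a] on each side. *)
Lemma eth_independent_between K n (U : structure (metric_language n))
    (d : U -> U -> nat) (M : set U) :
  small K nat -> saturated K U -> measures n d -> generic n d ->
  small K {x | M x} ->
  forall j a, n <= 2 ^ j.+1 * a ->
  forall X Y (x : X -> U) (y : Y -> U),
  (forall i v, moderate n d M a (2 ^ j.+1 * a - a).+1 (d (x i) (y v)) (x i) (y v)) ->
  eth_independent M j x y.
Proof.
move=> Kn Us md gd KM; elim=> [|j IH] a na.
  apply: (independent_between Kn Us md gd KM); [lia|lia|].
  by apply: (nondividing0 Kn Us md gd); lia.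
have pow : 2 ^ j.+1 = (2 ^ j).*2 by rewrite expnS mul2n.
have pow0 : 0 < 2 ^ j by rewrite expn_gt0.
have ea : a <= 2 ^ j * a by rewrite leq_pmull.
rewrite expnS pow in na IH *.
apply: (independent_between Kn Us md gd KM); [lia|lia|].
apply: (nondividing_step Kn Us md gd KM (IH a.*2 _)); lia.
Qed.

(** * Algebraic closure, and independence as disjointness over the base *)

Lemma copies n T (d : T -> T -> nat) J (t : J -> T) (u : T) :
  metric n d -> extends_over n d (join t (fun _ : unit => u)) -> 0 < n ->
  (forall j, t j <> u) ->
  exists s : nat -> T, [/\ s 0 = u, forall i j, d (s i) (t j) = d u (t j) &
    forall i i', d (s i) (s i') = (i != i')].
Proof.
move=> Md ext n0 tu.
have pos j : 0 < d u (t j).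
  by rewrite lt0n; apply/eqP => /(dist0_eq Md) /esym; exact: tu.
(* Copies are at mutual distance one, the least positive distance, and keep the positive distances
   of [u] to [t]. The point [tt] is [u] itself, at distance zero from copy [0]. *)
pose e (i : nat) (j : J + unit) : nat :=
  if j is inl j then d u (t j) else i != 0.
pose D (i i' : nat) : nat := i != i'.
have eD : amalgam n d (join t (fun _ : unit => u)) e D.
  rewrite /e /D; split=> [i|i i' [j|[]]|i i' [j|[]]|i|i i'|i i' i''|i i'].
  - split=> [[j|[]]|[j|[]] [j'|[]]] /=.
    + exact: dist_le Md _ _.
    + exact: leq_trans (leq_b1 _) n0.
    + have := distT Md u (t j') (t j); have := distT Md (t j) u (t j').
      by rewrite (distC Md (t j) u) (distC Md (t j') (t j)); lia.
    + by rewrite (distC Md (t j)); have := pos j; case: eqP; lia.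
    + by have := pos j'; case: eqP; lia.
    + by rewrite (distxx Md); lia.
  - by lia.
  - by lia.
  - by have := pos j; lia.
  - by lia.
  - by rewrite eqxx.
  - by rewrite eq_sym.
  - by lia.
  - exact: leq_trans (leq_b1 _) n0.
have [s [st ss]] := realize Md ext eD.
exists s; split=> [|i j|i i']; last exact: ss.
  by apply: (dist0_eq Md); exact: (st 0 (inr tt)).
exact: (st i (inl j)).
Qed.

Section Generic.
Variables (K : Type) (n : nat) (U : structure (metric_language n)).
Variables (d : U -> U -> nat) (M : set U).
Hypotheses (Kn : small K nat) (Us : saturated K U).
Hypotheses (md : measures n d) (gd : generic n d).
Hypotheses (KM : small K {x | M x}) (M0 : M !=set0).

Let Md : metric n d := proj1 gd.

(** For [n = 0] the space is a single point, which lies in the nonempty [M]. *)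
Lemma diff_pos (A : set U) u : M `<=` A -> ~ A u -> 0 < n.
Proof.
move=> MA Au; have [z Mz] := M0; have := dist_le Md z u.
case: (posnP n) => // ->; rewrite leqn0 => /eqP /(dist0_eq Md) zu.
by case: Au; apply: MA; rewrite -zu.
Qed.

(** A point outside [A] has infinitely many copies over the parameters, all satisfying the same
    formula by quantifier elimination. *)
Lemma acl_id (A : set U) : M `<=` A -> acl A = A.
Proof.
move=> MA; apply/seteqP; split=> u; last first.
  move=> Au; exists 1, (Equal (inl tt) (inr ord0)), (fun=> u); split=> //=.
  by rewrite (_ : [set v | v = u] = [set u]) //; exact: finite_set1.
move=> [m [p [c [cA up fin]]]]; apply: contrapT => Au.
have [s [s0 sc ss]] := copies Md (generic_extends gd) (diff_pos MA Au)
  (fun v => fun e : c v = u => Au (eq_ind _ A (cA v) _ e)).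
have sinj : injective s.
  move=> i i' e; have := ss i i'; rewrite e (distxx Md).
  by case: eqP.
apply: infinite_nat.
have -> : [set: nat] = s @^-1` [set v | sat (join (fun=> v) c) p].
  apply/seteqP; split=> // i _ /=.
  apply: (sat_join_isometry md gd) up => [x y _ _|x v _|//].
    by rewrite !(distxx Md).
  exact: sc.
by apply: finite_preimage fin => i i' _ _; exact: sinj.
Qed.

(** At level [0] the formula divides along copies of [u]. At a higher level, consistency would make
    the Morley sequence constantly [u]; its independence then contradicts the previous level. *)
Lemma eth_divides_equal X (x : X) k (u : U) : ~ M u ->
  eth_divides M k (Equal (inl x) (inr ord0) : formula _ (X + 'I_1)) (fun=> u).
Proof.
move=> Mu; elim: k X x => [|k IH] X x.
  have n0 := diff_pos (fun z => id) Mu.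
  pose t (z : {z | M z}) := sval z.
  have ext : extends_over n d (join t (fun _ : unit => u)).
    by apply: (saturated_extends Kn Us md gd); exact: small_sum.
  have [z zu|s [s0 st ss]] := copies Md ext n0.
    by apply: Mu; rewrite -zu; exact: svalP.
  exists (fun i _ => s i); split.
  - apply: (indiscernible_dist md gd) => [i j i' j' _ _ e|i j _ z Mz].
      by rewrite !ss e.
    by have := st i (exist _ z Mz); have := st j (exist _ z Mz) => /= -> ->.
  - by apply: funext => _; exact: s0.
  - move=> [a Ha]; have /= a0 := Ha 0; have /= a1 := Ha 1.
    by have := ss 0 1; rewrite -a0 -a1 (distxx Md).
move=> c [_ cM] c0 [a Ha].
have cu i : c i ord0 = u by have /= <- := Ha i; have /= -> := Ha 0; rewrite c0.
apply: (cM 1 1 (Equal (inl ord0) (inr ord0)) (fun=> u)) => [_||].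
- by right; exists (ord0, ord0) => //=; exact: cu.
- exact: cu.
- exists 1, (fun=> 1), (fun=> Equal (inl ord0) (inr ord0)), (fun _ _ => u).
  by split=> [_|a' e]; [exact: IH | exists ord0].
Qed.

(** A common point [u] outside [M] puts the dividing formula [x = u] into the type. Otherwise a
    distance between [a] and [b] vanishes only inside [M]. *)
Lemma eth_independentP k : n <= 2 ^ k.+1 ->
  forall (X Y : Type) (a : X -> U) (b : Y -> U),
  eth_independent M k a b <-> (M `|` range a) `&` (M `|` range b) = M.
Proof.
move=> nk X Y a b.
have -> : (M `|` range a) `&` (M `|` range b) = M <->
    forall x y, a x = b y -> M (a x).
  split=> [E x y axy|H].
    by rewrite -E; split; right; [exists x | rewrite axy; exists y].
  apply/seteqP; split=> [u [[//|[x _ <-]] [//|[y _ bx]]]|u Mu].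
    exact: (H x y).
  by split; left.
split=> [ind x y axy|H].
  apply: contrapT => Ma.
  apply: (ind 1 (Equal (inl x) (inr ord0)) (fun=> b y)) => [_|//|].
    by right; exists y.
  exists 1, (fun=> 1), (fun=> Equal (inl x) (inr ord0)), (fun _ _ => b y).
  split=> [_|a' e]; last by exists ord0.
  by rewrite -axy; exact: eth_divides_equal.
(* With lower end [1] the interval is [[1, 2 ^ k.+1]], which contains all positive distances. *)
apply: (@eth_independent_between K n U d M Kn Us md gd KM k 1).
  by rewrite muln1.
move=> x y; have [Ma|Ma] := EM (M (a x)).
  by apply: moderate_base => //; left.
split.
  apply: Or31; rewrite lt0n; apply/eqP => /(dist0_eq Md) axy.
  by apply: Ma; exact: H axy.
left; rewrite muln1; apply: leq_trans (dist_le Md _ _) _.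
by apply: leq_trans nk _; lia.
Qed.

End Generic.

Theorem theorem3p2 :
  (forall (n k : nat) (T : theory (metric_language n)),
     model_companion T (metric_theory n) -> n <= 2 ^ k.+1 ->
   forall (K : Type) (U : structure (metric_language n)),
     model T U -> monster K U ->
   forall M : set U, small K {x | M x} -> elementary_substructure M ->
   forall (X Y : Type) (a : X -> U) (b : Y -> U), small K X -> small K Y ->
     (eth_independent M k a b <->
        (M `|` range a) `&` (M `|` range b) = M) /\
     (eth_independent M k a b <-> alg_independent M a b)) /\
  (forall k : nat, exists (L : language) (T : theory L),
     [/\ complete_theory T, SOP (2 ^ k.+1) T & eth_symmetric k T]).
Proof.
split.
  move=> n k T TC nk K U TU [Kn _ Us _] M KM [M0 _] X Y a b _ _.
  have [d [md gd]] := companion_generic TC TU.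
  have indP := eth_independentP Kn Us md gd KM M0 nk a b.
  split=> //; rewrite /alg_independent !(acl_id md gd M0) //;
    by move=> ?; left.
move=> k; have : 1 < 2 ^ k.+1 by rewrite (ltn_exp2l 0).
have : 2 ^ k.+1 <= 2 ^ k.+1 by [].
(* The bound [n] is [2 ^ k.+1] written as [q.+1]; the right-hand side of [nk] keeps the power. *)
case: {1 3 4}(2 ^ k.+1) => // q nk q0.
have gl := @limit_dist_generic q.+1 isT.
pose G := metric_structure q.+1 (limit_dist q.+1).
have mG := @metric_structure_measures q.+1 _ (limit_dist q.+1).
exists (metric_language q.+1), (theory_of G); split.
- exact: theory_of_complete (inhabits (0 : G)).
- exact: generic_SOP mG gl (inhabits (0 : G)).
move=> K U TU [Kn _ Us _] M KM [M0 _] X Y a b _ _.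
have [d [md gd]] := theory_of_generic mG gl (inhabits (0 : G)) TU.
by move=> /(eth_independentP Kn Us md gd KM M0 nk); rewrite setIC =>
  /(eth_independentP Kn Us md gd KM M0 nk).
Qed.
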